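(* Let $e\in\mathbb{S}^{N-1}$. In the scalar setting on $\Omega=\mathbb{R}^N$ described in the context, assume that $A$, $q$, $f$ and $p^\pm$ do not depend on $t$, that $A$ and $q$ are constant (also independent of $x$), that the functions $p^\pm=p^\pm(x\cdot e)$ depend only on $x\cdot e$ and are nonincreasing in $x\cdot e$, that $f=f(x\cdot e,u)$ is nonincreasing in $x\cdot e$, that there is $\delta>0$ such that, for all $x\in\mathbb{R}^N$, $s\mapsto f(x\cdot e,s)$ is nonincreasing in $(-\infty,p^-(x\cdot e)+\delta]$ and in $[p^+(x\cdot e)-\delta,+\infty)$, and that $\inf\{p^+(x\cdot e)-p^-(x\cdot e);\ x\in\mathbb{R}^N\}>0$. Let $u$ be a globally bounded transition wave connecting $p^-$ and $p^+$ for (E) which is almost planar in the direction $e$ with $$\Omega^\pm_t=\{x\in\mathbb{R}^N;\ \pm(x\cdot e-\xi_t)<0\},\quad t\in\mathbb{R},$$ where the function $t\mapsto\xi_t$ is bounded on $\mathbb{R}$. Then $u$ depends on $x\cdot e$ only, that is, $u$ is a stationary one-dimensional front.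
   Context: $N\ge1$. Equation (E) (scalar, on $\mathbb{R}^N$): $$u_t=\nabla_x\cdot(A\nabla_xu)+q\cdot\nabla_xu+f(x,u),\qquad (t,x)\in\mathbb{R}\times\mathbb{R}^N,$$ where $A=(a_{ij})$ is a matrix with $\alpha_1|\xi|^2\le\sum_{i,j}a_{ij}\xi_i\xi_j\le\alpha_2|\xi|^2$ for some constants $0<\alpha_1\le\alpha_2$ and all $\xi\in\mathbb{R}^N$; $q\in\mathbb{R}^N$; and, for some $\beta>0$, $f:\mathbb{R}^N\times\mathbb{R}\to\mathbb{R}$ is $C^{0,\beta}$ in $x$ locally in $u$, and locally Lipschitz-continuous in $u$ uniformly with respect to $x$. The functions $p^\pm$ are globally bounded classical solutions of (E). Transition wave. With $\Omega=\mathbb{R}^N$ and the sets $\Omega^\pm_t=\{x\in\mathbb{R}^N;\ \pm(x\cdot e-\xi_t)<0\}$, $\Gamma_t=\{x\in\mathbb{R}^N;\ x\cdot e=\xi_t\}$, the paper's general definition of a transition wave connecting $p^-$ and $p^+$ (almost planar in the direction $e$) amounts to the following: $u$ is a time-global (defined for all $t\in\mathbb{R}$) classical solution of (E), $u\not\equiv p^\pm$, and for every $\varepsilon>0$ there is $M\ge0$ such that for all $(t,x)\in\mathbb{R}\times\mathbb{R}^N$: $x\cdot e-\xi_t\le-M$ implies $|u(t,x)-p^+(x\cdot e)|\le\varepsilon$, and $x\cdot e-\xi_t\ge M$ implies $|u(t,x)-p^-(x\cdot e)|\le\varepsilon$. *)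

(* Defs.v *)
From HB Require Import structures.
From mathcomp Require Import all_boot all_order all_algebra.
From mathcomp Require Import all_classical all_reals all_analysis.
Import Order.TTheory GRing.Theory Num.Theory.
Import numFieldNormedType.Exports.

Set Implicit Arguments.
Unset Strict Implicit.
Unset Printing Implicit Defensive.

Local Open Scope classical_set_scope.
Local Open Scope ring_scope.

(* The norm carried by the normedModType 'rV[R]_N is the sup norm; it induces
   the usual topology, but Euclidean lengths are measured with [enorm]. *)
Definition dotp (R : realType) (N : nat) (x y : 'rV[R]_N) : R :=
  \sum_(i < N) x 0 i * y 0 i.

Definition enorm (R : realType) (N : nat) (x : 'rV[R]_N) : R :=
  Num.sqrt (dotp x x).

Definition basis_vec (R : realType) (N : nat) (i : 'I_N) : 'rV[R]_N :=
  delta_mx 0 i.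

Definition partial (R : realType) (N : nat) (i : 'I_N) (v : 'rV[R]_N -> R)
    (x : 'rV[R]_N) : R :=
  'D_(basis_vec R i) v x.

Definition gradient (R : realType) (N : nat) (v : 'rV[R]_N -> R)
    (x : 'rV[R]_N) : 'rV[R]_N :=
  \row_i partial i v x.

Definition divergence (R : realType) (N : nat) (V : 'rV[R]_N -> 'rV[R]_N)
    (x : 'rV[R]_N) : R :=
  \sum_(i < N) partial i (fun y => V y 0 i) x.

(* Symmetry of [A] is not required. *)
Definition elliptic (R : realType) (N : nat) (A : 'M[R]_N) : Prop :=
  exists alpha1 alpha2 : R,
    [/\ 0 < alpha1, alpha1 <= alpha2 &
        forall xi : 'rV[R]_N,
          alpha1 * enorm xi ^+ 2
            <= \sum_(i < N) \sum_(j < N) A i j * xi 0 i * xi 0 j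
            <= alpha2 * enorm xi ^+ 2].

Definition holder_in_x (R : realType) (N : nat) (beta : R)
    (F : 'rV[R]_N -> R -> R) : Prop :=
  forall K : R, exists C : R, forall (s : R) (x y : 'rV[R]_N),
    `|s| <= K -> `|F x s - F y s| <= C * enorm (x - y) `^ beta.

Definition locally_lipschitz_in_u (R : realType) (N : nat)
    (F : 'rV[R]_N -> R -> R) : Prop :=
  forall K : R, exists L : R, forall (x : 'rV[R]_N) (s s' : R),
    `|s| <= K -> `|s'| <= K -> `|F x s - F x s'| <= L * `|s - s'|.

(* C^1 in t and C^2 in x, all derivatives being continuous in (t, x) jointly. *)
Definition C12 (R : realType) (N : nat) (u : R -> 'rV[R]_N -> R) : Prop :=
  [/\ forall t x, derivable (u ^~ x) t 1,
      forall t x i, derivable (u t) x (basis_vec R i),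
      forall t x i j, derivable (partial i (u t)) x (basis_vec R j) &
   [/\ continuous (fun z : R * 'rV[R]_N => u z.1 z.2),
      continuous (fun z : R * 'rV[R]_N => derive1 (u ^~ z.2) z.1),
      forall i, continuous (fun z : R * 'rV[R]_N => partial i (u z.1) z.2) &
      forall i j, continuous
        (fun z : R * 'rV[R]_N => partial j (partial i (u z.1)) z.2)]].

(* Vectors are rows, so the column A (grad u) is the row (grad u) *m A^T. *)
Definition classical_solution (R : realType) (N : nat) (A : 'M[R]_N)
    (q : 'rV[R]_N) (F : 'rV[R]_N -> R -> R) (u : R -> 'rV[R]_N -> R) : Prop :=
  C12 u /\
  forall t x,
    derive1 (u ^~ x) t
      = divergence (fun y => gradient (u t) y *m A^T) x
        + dotp q (gradient (u t) x) + F x (u t x).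

(* [pm], [pp] are the profiles of the limiting states p^-, p^+, which are the
   functions (t, x) |-> pm (x . e), pp (x . e); note that p^+ is approached
   where x . e - xi t is very negative. *)
Definition transition_wave (R : realType) (N : nat) (A : 'M[R]_N)
    (q : 'rV[R]_N) (F : 'rV[R]_N -> R -> R) (e : 'rV[R]_N) (pm pp : R -> R)
    (xi : R -> R) (u : R -> 'rV[R]_N -> R) : Prop :=
  [/\ classical_solution A q F u,
      exists t x, u t x != pm (dotp x e),
      exists t x, u t x != pp (dotp x e) &
      forall eps : R, 0 < eps -> exists2 M : R, 0 <= M &
        forall t x,
          (dotp x e - xi t <= - M -> `|u t x - pp (dotp x e)| <= eps) /\
          (M <= dotp x e - xi t -> `|u t x - pm (dotp x e)| <= eps)].

(* Main.v *)
Require Import Defs.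
From HB Require Import structures.
From mathcomp Require Import all_boot all_order all_algebra.
From mathcomp Require Import all_classical all_reals all_analysis.
From mathcomp Require Import ring lra.
Import Order.TTheory GRing.Theory Num.Theory.
Import numFieldNormedType.Exports.

Local Open Scope classical_set_scope.
Local Open Scope ring_scope.

(** The proof is the sliding method. For a time shift [s] and a vector [eta]
    orthogonal to [e], compare [u (t, x)] with its translate
    [u (t + s, x + eta + tau e)], and decrease [tau] from large values. If the
    translate stays below [u] for all [tau >= 0], then
    [u (t + s, x + eta) <= u (t, x)]; as [s] and [eta] are arbitrary, equality
    holds, and [u] depends on [x . e] only.

    Since [xi] is bounded, [u] is uniformly close to [p^+] for [x . e] very
    negative and to [p^-] for [x . e] very positive. There the monotonicity of [f]
    in [u] gives a comparison principle ([supersolution_ge0]), which handles large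
    [tau] and, for the other [tau >= 0], reduces the ordering to a bounded strip
    of values of [x . e]. At a critical shift [tau > 0] the difference [z] between
    [u] and its translate is nonnegative, and the point is to bound it below on
    the strip uniformly. Instead of extracting a limit of translates of [u] and
    applying the strong maximum principle to it, the argument is quantitative. The
    sum of [z] along an orbit of the shift telescopes to a difference between
    values of [u] near [p^+] and near [p^-], so [z] is bounded below somewhere on
    each orbit; the Lipschitz continuity of [u] in [x] ([solution_space_lipschitz])
    carries this to a ball of fixed radius; and an explicit barrier
    ([positivity_spreads]) carries it to all points of the strip, at later times.

    No regularity theory is involved. The symmetric part of [A] is a sum of squares
    [c^T c] ([positive_form_sum_squares]), so the equation only contains second
    derivatives along lines. The Lipschitz bound comes from doubling the variable:
    the increment of [u] over a segment, as a function of the midpoint and of the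
    length of the segment, solves a parabolic equation in all these variables
    ([increment_le]); its source stays bounded by the Holder continuity of [f] in
    [x] and its Lipschitz continuity in [u]. All the maximum principles on
    unbounded domains come from [almost_minimum]: a function bounded below has
    almost minimal points at which its derivatives almost satisfy the conditions
    for a minimum. *)

Set Implicit Arguments.
Unset Strict Implicit.
Unset Printing Implicit Defensive.

(** * First and second order expansions of functions of one variable *)

Section Jets.
Variable R : realType.
Implicit Types (r s k g : R -> R) (d : R).

Definition little_power (n : nat) r : Prop :=
  forall eps : R, 0 < eps -> exists2 rho : R, 0 < rho &
    forall h : R, `|h| < rho -> `|r h| <= eps * `|h| ^+ n.

Lemma little_powerD n r s :
  little_power n r -> little_power n s -> little_power n (fun h => r h + s h).
Proof.
move=> lr ls eps e0.
have e2 : 0 < eps / 2 by rewrite divr_gt0.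
have [a a0 ha] := lr _ e2; have [b b0 hb] := ls _ e2.
exists (Num.min a b); first by rewrite lt_min a0.
move=> h; rewrite lt_min => /andP[/ha h1 /hb h2].
rewrite (le_trans (ler_normD _ _))// (le_trans (lerD h1 h2))//.
by rewrite -mulrDl -splitr.
Qed.

Lemma little_powerZ n c r :
  little_power n r -> little_power n (fun h => c * r h).
Proof.
move=> lr eps e0; have c0 : 0 < `|c| + 1 by rewrite ltr_wpDl.
have [a a0 ha] := lr _ (divr_gt0 e0 c0); exists a => // h /ha hh.
rewrite normrM (le_trans (ler_wpM2l (normr_ge0 _) hh))// mulrA.
rewrite ler_wpM2r ?exprn_ge0// mulrCA ler_piMr ?(ltW e0)//.
by rewrite ler_pdivrMr// mul1r lerDl.
Qed.

Lemma little_power_le n C r : (forall h, `|h| <= 1 -> `|r h| <= C * `|h| ^+ n.+1) ->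
  little_power n r.
Proof.
move=> rC eps e0.
have C0 : 0 < `|C| + 1 by rewrite ltr_wpDl.
exists (Num.min 1 (eps / (`|C| + 1))); first by rewrite lt_min ltr01 divr_gt0.
move=> h; rewrite lt_min ltr_pdivlMr// => /andP[h1 h2].
apply: (le_trans (rC _ (ltW h1))).
rewrite exprS mulrA ler_wpM2r ?exprn_ge0//.
rewrite (le_trans _ (ltW h2))// mulrC ler_wpM2l//.
by rewrite (le_trans (ler_norm _))// lerDl.
Qed.

Lemma little_powerS n r : little_power n.+1 r -> little_power n r.
Proof.
move=> lr eps e0; have [a a0 ha] := lr _ e0.
exists (Num.min 1 a); first by rewrite lt_min ltr01.
move=> h; rewrite lt_min => /andP[h1 /ha hh]; apply: (le_trans hh).
by rewrite ler_wpM2l ?(ltW e0)// exprS ler_piMl ?exprn_ge0// ltW.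
Qed.

Lemma little_power_opp n r : little_power n r -> little_power n (fun h => r (- h)).
Proof.
move=> lr eps e0; have [a a0 ha] := lr _ e0; exists a => // h hh.
by have := ha (- h); rewrite normrN; apply.
Qed.

(** Expansions at [0] serve instead of derivatives: they restrict to lines, are
    stable under linear operations, and are exactly what the tests for the
    derivatives at a minimum use. *)
Definition jet1 k d : Prop := little_power 1 (fun h => k h - k 0 - d * h).

Definition jet2 k (d1 d2 : R) : Prop :=
  little_power 2 (fun h => k h - k 0 - d1 * h - d2 / 2 * h ^+ 2).

End Jets.

Lemma jet1_is_derive (R : realType) (V : normedModType R) (w : V -> R) x v d :
  jet1 (fun h => w (x + h *: v)) d <-> is_derive x v w d.
Proof.
have -> : is_derive x v w d <->
    (fun h => h^-1 *: ((w \o shift x) (h *: v) - w x)) @ (0 : R)^' --> d.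
  split=> [[dw <-]|wd]; first exact: dw.
  by split; [apply/cvg_ex; exists d | exact: cvg_lim].
split=> [jw|].
- apply/cvgrPdist_le => e e0; have [rho rho0 H] := jw _ e0.
  near=> h; have h0 : h != 0 by near: h; exact: nbhs_dnbhs_neq.
  have hr : `|h| < rho by near: h; exact: dnbhs0_lt.
  have := H _ hr; rewrite scale0r addr0 expr1 /= [h *: v + x]addrC => {}H.
  rewrite -[d](mulKf h0) -[_ *: _]/(_ * _) -mulrBr normrM normfV.
  rewrite ler_pdivrMl ?normr_gt0//.
  rewrite distrC [h * d]mulrC [`|h| * e]mulrC; exact: H.
- move=> /cvgrPdist_le cw eps e0; have := cw _ e0.
  rewrite near_withinE => /nbhs_normP[rho /= rho0 H]; exists rho => // h hr.
  have [->|h0] := eqVneq h 0; first by rewrite scale0r subrr mulr0 subrr !normr0 mulr0.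
  have := H h; rewrite /= sub0r normrN => /(_ hr h0).
  rewrite -[in X in X -> _](mulKf h0 d) -[_ *: _]/(_ * _) -mulrBr normrM normfV.
  rewrite ler_pdivrMl ?normr_gt0// distrC [h * d]mulrC [`|h| * eps]mulrC.
  by rewrite scale0r addr0 expr1 [h *: v + x]addrC.
Unshelve. all: by end_near. Qed.

Section JetCalculus.
Variable R : realType.
Implicit Types (k g : R -> R) (d : R).

Lemma is_derive_jet1 k x d : jet1 (fun h => k (x + h)) d <-> is_derive x (1 : R) k d.
Proof.
rewrite -jet1_is_derive; suff -> : (fun h => k (x + h *: (1 : R))) = (fun h => k (x + h)) by [].
by apply/funext => h; rewrite [_%:A]mulr1.
Qed.

Lemma jet2_jet1 k d1 d2 : jet2 k d1 d2 -> jet1 k d1.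
Proof.
move=> /little_powerS j.
have l2 : little_power 1 (fun h : R => d2 / 2 * h ^+ 2).
  by apply: (@little_power_le _ _ `|d2 / 2|) => h _; rewrite normrM normrX.
by have := little_powerD j l2; congr little_power; apply/funext => h; ring.
Qed.

Lemma jet1D k g d d' : jet1 k d -> jet1 g d' -> jet1 (fun h => k h + g h) (d + d').
Proof.
by move=> jk jg; have := little_powerD jk jg; congr little_power; apply/funext => h; ring.
Qed.

Lemma jet1Z c k d : jet1 k d -> jet1 (fun h => c * k h) (c * d).
Proof.
by move=> jk; have := little_powerZ c jk; congr little_power; apply/funext => h; ring.
Qed.

Lemma jet1B k g d d' : jet1 k d -> jet1 g d' -> jet1 (fun h => k h - g h) (d - d').
Proof.
move=> jk /(jet1Z (-1)) jg; rewrite -[- d']mulN1r.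
by have := jet1D jk jg; congr jet1; apply/funext => h; rewrite mulN1r.
Qed.

Lemma jet2D k g d1 d1' d2 d2' :
  jet2 k d1 d2 -> jet2 g d1' d2' -> jet2 (fun h => k h + g h) (d1 + d1') (d2 + d2').
Proof.
move=> jk jg; have := little_powerD jk jg; congr little_power; apply/funext => h.
by field.
Qed.

Lemma jet2Z c k d1 d2 : jet2 k d1 d2 -> jet2 (fun h => c * k h) (c * d1) (c * d2).
Proof.
move=> jk; have := little_powerZ c jk; congr little_power; apply/funext => h.
by field.
Qed.

Lemma jet2B k g d1 d1' d2 d2' :
  jet2 k d1 d2 -> jet2 g d1' d2' -> jet2 (fun h => k h - g h) (d1 - d1') (d2 - d2').
Proof.
move=> jk /(jet2Z (-1)) jg; rewrite -[- d1']mulN1r -[- d2']mulN1r.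
by have := jet2D jk jg; congr jet2; apply/funext => h; rewrite mulN1r.
Qed.

Lemma jet1_opp k d : jet1 k d -> jet1 (fun h => k (- h)) (- d).
Proof.
move=> /little_power_opp; congr little_power; apply/funext => h; rewrite oppr0; ring.
Qed.

Lemma jet2_opp k d1 d2 : jet2 k d1 d2 -> jet2 (fun h => k (- h)) (- d1) d2.
Proof.
move=> /little_power_opp; congr little_power; apply/funext => h; rewrite oppr0; ring.
Qed.

Lemma jet1_mean_value k g : (forall x, jet1 (fun h => k (x + h)) (g x)) ->
  forall h, exists2 th, `|th| <= `|h| & k h - k 0 = g th * h.
Proof.
move=> jk; have dk x : is_derive x (1 : R) k (g x) by apply/is_derive_jet1.
have ck : continuous k.
  move=> x; apply: differentiable_continuous; apply/derivable1_diffP.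
  by have [] := dk x.
move=> h; have [h0|h0] := leP 0 h.
- have [|c] := MVT_segment h0 (fun x _ => dk x); first exact: continuous_subspaceT.
  rewrite in_itv/= subr0 => /andP[c0 ch] e; exists c => //.
  by rewrite !ger0_norm.
- have [|c] := MVT_segment (ltW h0) (fun x _ => dk x).
    exact: continuous_subspaceT.
  rewrite in_itv/= sub0r => /andP[c0 ch] e; exists c => //.
    by rewrite !ler0_norm ?lerN2// ltW.
  by rewrite -opprB e mulrN opprK.
Qed.

(** Taylor-Young: the remainder has derivative [o(h)], so it is [o(h^2)] by the
    mean value theorem. *)
Lemma taylor_young k g d2 : (forall x, jet1 (fun h => k (x + h)) (g x)) ->
  jet1 g d2 -> jet2 k (g 0) d2.
Proof.
move=> jk jg eps e0; have [rho rho0 H] := jg _ e0; exists rho => // h hr.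
pose r := fun h => k h - k 0 - g 0 * h - d2 / 2 * h ^+ 2.
have jr x : jet1 (fun h => r (x + h)) (g x - g 0 - d2 * x).
  have l2 : little_power 1 (fun h : R => (- d2 / 2) * h ^+ 2).
    by apply: (@little_power_le _ _ `|- d2 / 2|) => y _; rewrite normrM normrX.
  have := little_powerD (jk x) l2; congr little_power; apply/funext => y.
  by rewrite /r addr0; field.
have [th thh] := jet1_mean_value jr h.
rewrite {1}/r {1}/r => e.
have -> : k h - k 0 - g 0 * h - d2 / 2 * h ^+ 2 = (g th - g 0 - d2 * th) * h.
  by rewrite -e; ring.
rewrite normrM expr2 mulrA ler_wpM2r//.
have := H th (le_lt_trans thh hr); rewrite expr1 => /le_trans; apply.
by rewrite ler_wpM2l// ltW.
Qed.

Lemma jet2_poly3 (a b c e4 e5 : R) :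
  jet2 (fun h => a + b * h + c * h ^+ 2 + e4 * h ^+ 3 + e5 * h ^+ 4) b (2 * c).
Proof.
apply: (@little_power_le _ _ (`|e4| + `|e5|)) => h h1.
have -> : a + b * h + c * h ^+ 2 + e4 * h ^+ 3 + e5 * h ^+ 4 -
  (a + b * 0 + c * 0 ^+ 2 + e4 * 0 ^+ 3 + e5 * 0 ^+ 4) -
   b * h - 2 * c / 2 * h ^+ 2 = (e4 + e5 * h) * h ^+ 3 by field.
rewrite normrM normrX ler_wpM2r ?exprn_ge0//.
rewrite (le_trans (ler_normD _ _))// lerD2l normrM ler_piMr//.
Qed.

Lemma jet2_expR (c x a : R) :
  jet2 (fun h => c * expR (x + h * a)) (c * (a * expR x)) (c * (a ^+ 2 * expR x)).
Proof.
have J y : jet1 (fun h => expR (x + (y + h) * a)) (a * expR (x + y * a)).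
  have : is_derive y (1 : R) (fun h => expR (x + h * a)) (a * expR (x + y * a)).
    apply: is_derive_eq.
    by rewrite add0r mul1r scaler0 add0r [_%:A]mulr1 mulrC.
  by move/is_derive_jet1.
apply: jet2Z.
have := @taylor_young (fun h => expR (x + h * a)) (fun h => a * expR (x + h * a))
   (a ^+ 2 * expR x) J.
rewrite mul0r addr0; apply.
rewrite expr2 -mulrA; apply: jet1Z.
have := J 0; rewrite mul0r addr0; congr jet1; apply/funext => h.
by rewrite add0r.
Qed.

End JetCalculus.

(** * Calculus along lines in several variables *)

Section LineCalculus.
Variables (R : realType) (V : normedModType R).
Implicit Types (w : V -> R) (x y a b : V).

Lemma continuous_eps (w : V -> R) x (eps : R) : {for x, continuous w} -> 0 < eps ->
  exists2 rho, 0 < rho & forall y, `|y| < rho -> `|w (x + y) - w x| <= eps.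
Proof.
move=> /cvgrPdist_le cw e0; have /nbhs_normP[rho /= rho0 H] := cw _ e0.
exists rho => // y yr; rewrite distrC; apply: H => /=.
by rewrite opprD addNKr normrN.
Qed.

(** Moving along one direction at a time, each increment is a mean value of a
    partial derivative, which is continuous. *)
Lemma chain_rule (I : Type) (r : seq I) (c : I -> R) (b : I -> V) w (p : I -> V -> R) x :
  (forall i y, jet1 (fun h => w (y + h *: b i)) (p i y)) ->
  (forall i, {for x, continuous (p i)}) ->
  jet1 (fun h => w (x + h *: (\sum_(i <- r) c i *: b i))) (\sum_(i <- r) c i * p i x).
Proof.
move=> jp cp; elim: r => [|i r IH].
  rewrite !big_nil => e e0; exists 1 => // h _.
  by rewrite !scaler0 subrr mul0r subr0 normr0 mulr_ge0// ltW.
rewrite !big_cons; set s := \sum_(j <- r) c j *: b j in IH *.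
set d := \sum_(j <- r) c j * p j x in IH *.
have l : little_power 1 (fun h : R => w (x + h *: (c i *: b i + s)) - w (x + h *: s)
    - (c i * p i x) * h).
  move=> e e0; have K0 : 0 < `|c i| + 1 by rewrite ltr_wpDl.
  have [rho rho0 H] := continuous_eps (cp i) (divr_gt0 e0 K0).
  have M0 : 0 < `|s| + `|c i| * `|b i| + 1.
    by rewrite ltr_wpDl// addr_ge0// mulr_ge0.
  exists (rho / (`|s| + `|c i| * `|b i| + 1)); first by rewrite divr_gt0.
  move=> h; rewrite ltr_pdivlMr// => hr.
  have [|th thh] := @jet1_mean_value _ (fun t => w (x + h *: s + t *: b i))
     (fun t => p i (x + h *: s + t *: b i)) _ (h * c i).
    move=> t; have := jp i (x + h *: s + t *: b i); congr jet1; apply/funext => h'.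
    by rewrite -addrA -scalerDl.
  rewrite scale0r addr0 -addrA -scalerA -scalerDr [s + _]addrC => ->.
  have -> : p i (x + h *: s + th *: b i) * (h * c i) - c i * p i x * h =
    c i * (p i (x + (h *: s + th *: b i)) - p i x) * h by rewrite addrA; ring.
  rewrite expr1 !normrM ler_wpM2r//.
  have nr : `|h *: s + th *: b i| < rho.
    apply: le_lt_trans hr; rewrite (le_trans (ler_normD _ _))// !normrZ.
    rewrite !mulrDr mulr1 -addrA lerD2l.
    rewrite -[leLHS]addr0 lerD// mulrA ler_wpM2r//.
    by rewrite (le_trans thh)// normrM.
  apply: (le_trans (ler_wpM2l (normr_ge0 _) (H _ nr))).
  rewrite mulrCA ler_piMr ?(ltW e0)// ler_pdivrMr// mul1r lerDl//.
have := little_powerD l IH; congr little_power; apply/funext => h.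
by rewrite !scale0r !addr0; ring.
Qed.

(** The second difference is symmetric in [a] and [b], while the right-hand side
    is a mixed derivative in which [a] comes first. *)
Lemma second_difference w (wa wab : V -> R) a b :
  (forall y, jet1 (fun h => w (y + h *: a)) (wa y)) ->
  (forall y, jet1 (fun h => wa (y + h *: b)) (wab y)) ->
  forall x h, exists th th', [/\ `|th| <= `|h|, `|th'| <= `|h| &
    w (x + h *: a + h *: b) - w (x + h *: a) - w (x + h *: b) + w x =
    wab (x + (th *: a + th' *: b)) * h ^+ 2].
Proof.
move=> ja jab x h.
have [|th thh e] := @jet1_mean_value _ (fun t => w (x + t *: a + h *: b) - w (x + t *: a))
     (fun t => wa (x + t *: a + h *: b) - wa (x + t *: a)) _ h.
  move=> t; apply: jet1B.
  - have := ja (x + t *: a + h *: b); congr jet1; apply/funext => h'.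
    by rewrite scalerDl addrAC !addrA.
  - have := ja (x + t *: a); congr jet1; apply/funext => h'.
    by rewrite scalerDl !addrA.
have [|th' thh' e'] := @jet1_mean_value _ (fun t => wa (x + th *: a + t *: b))
     (fun t => wab (x + th *: a + t *: b)) _ h.
  move=> t; have := jab (x + th *: a + t *: b); congr jet1; apply/funext => h'.
  by rewrite scalerDl !addrA.
exists th, th'; split=> //.
move: e e'; rewrite !scale0r !addr0 => e e'.
rewrite addrA expr2 mulrA -e' -e; ring.
Qed.

(** Both mixed derivatives are limits of the same second difference quotient. *)
Lemma schwarz w (wa wb wab wba : V -> R) a b x :
  (forall y, jet1 (fun h => w (y + h *: a)) (wa y)) ->
  (forall y, jet1 (fun h => w (y + h *: b)) (wb y)) ->
  (forall y, jet1 (fun h => wa (y + h *: b)) (wab y)) ->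
  (forall y, jet1 (fun h => wb (y + h *: a)) (wba y)) ->
  {for x, continuous wab} -> {for x, continuous wba} ->
  wab x = wba x.
Proof.
move=> ja jb jab jba cab cba.
apply/eqP; rewrite -subr_eq0 -normr_le0; apply/ler_addgt0Pr => e e0; rewrite add0r.
have e2 : 0 < e / 2 by rewrite divr_gt0.
have [r1 r10 H1] := continuous_eps cab e2.
have [r2 r20 H2] := continuous_eps cba e2.
have M0 : 0 < `|a| + `|b| + 1 by rewrite ltr_wpDl// addr_ge0.
pose h := Num.min r1 r2 / 2 / (`|a| + `|b| + 1).
have h0 : 0 < h by rewrite divr_gt0// divr_gt0// lt_min r10.
have small th th' : `|th| <= `|h| -> `|th'| <= `|h| ->
   `|th *: a + th' *: b| < Num.min r1 r2.
  move=> t1 t2; apply: (@le_lt_trans _ _ (h * (`|a| + `|b| + 1))).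
    rewrite (le_trans (ler_normD _ _))// !normrZ mulrDr mulr1.
    rewrite -[leLHS]addr0 lerD ?(ltW h0)// mulrDr.
    by move: t1 t2; rewrite (gtr0_norm h0) => t1 t2; rewrite lerD// ler_wpM2r.
  rewrite divfK ?gt_eqF// ltr_pdivrMr// ltr_pMr ?ltr1n// lt_min r10//.
have [th1 [th1' [t1 t1' e1]]] := second_difference ja jab x h.
have [th2 [th2' [t2 t2' e2']]] := second_difference jb jba x h.
have ee : wab (x + (th1 *: a + th1' *: b)) = wba (x + (th2 *: b + th2' *: a)).
  apply: (@mulIf _ (h ^+ 2)); first by rewrite expf_neq0// gt_eqF.
  by rewrite -e1 -e2' [x + h *: a + h *: b]addrAC; ring.
have := small _ _ t1 t1'; rewrite lt_min => /andP[/H1 + _].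
have := small _ _ t2' t2; rewrite lt_min [th2' *: a + _]addrC => /andP[_ /H2].
rewrite -ee => A1 A2.
rewrite -[wab x - wba x](subrKA (wab (x + (th1 *: a + th1' *: b)))).
rewrite (le_trans (ler_normD _ _))// [leRHS]splitr lerD//.
by rewrite distrC.
Qed.

End LineCalculus.

(** * The dot product, and quadratic forms as sums of squares *)

Section DotProduct.
Variables (R : realType) (N : nat).
Implicit Types (x y z e : 'rV[R]_N) (S : 'M[R]_N).

Lemma dotpC x y : dotp x y = dotp y x.
Proof. by apply: eq_bigr => i _; rewrite mulrC. Qed.

Lemma dotpDl x y z : dotp (x + y) z = dotp x z + dotp y z.
Proof. by rewrite /dotp -big_split; apply: eq_bigr => i _; rewrite mxE mulrDl. Qed.

Lemma dotpZl (a : R) x z : dotp (a *: x) z = a * dotp x z.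
Proof. by rewrite /dotp mulr_sumr; apply: eq_bigr => i _; rewrite mxE mulrA. Qed.

Lemma dotpDr x y z : dotp z (x + y) = dotp z x + dotp z y.
Proof. by rewrite dotpC dotpDl !(dotpC z). Qed.

Lemma dotpZr (a : R) x z : dotp z (a *: x) = a * dotp z x.
Proof. by rewrite dotpC dotpZl (dotpC z). Qed.

Lemma dotpNl x z : dotp (- x) z = - dotp x z.
Proof. by rewrite -scaleN1r dotpZl mulN1r. Qed.

Lemma dotpNr x z : dotp z (- x) = - dotp z x.
Proof. by rewrite dotpC dotpNl dotpC. Qed.

Lemma dotp0l x : dotp 0 x = 0.
Proof. by rewrite -(scale0r 0) dotpZl mul0r. Qed.

Lemma dotp_ge0 x : 0 <= dotp x x.
Proof. by apply: sumr_ge0 => i _; rewrite -expr2 sqr_ge0. Qed.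

Lemma dotp_delta x i : dotp x (delta_mx 0 i) = x 0 i.
Proof.
rewrite /dotp (bigD1 i)//= mxE !eqxx mulr1 big1 ?addr0// => j ji.
by rewrite mxE eqxx/= (negbTE ji) mulr0.
Qed.

Lemma coord_sqr_le x i : x 0 i ^+ 2 <= dotp x x.
Proof.
by rewrite /dotp (bigD1 i)//= -expr2 lerDl sumr_ge0// => j _; rewrite -expr2 sqr_ge0.
Qed.

Lemma dotp_eq0 x : dotp x x = 0 -> x = 0.
Proof.
move=> x0; apply/rowP => i; rewrite mxE; apply/eqP.
by rewrite -sqrf_eq0 eq_le sqr_ge0 andbT -x0 coord_sqr_le.
Qed.

Lemma sqr_dotp_le x y : dotp x y ^+ 2 <= dotp x x * dotp y y.
Proof.
have [y0|y0] := eqVneq (dotp y y) 0.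
  by rewrite (dotp_eq0 y0) dotpC !dotp0l mulr0 expr2 mulr0.
have yp : 0 < dotp y y by rewrite lt_def y0 dotp_ge0.
have := dotp_ge0 (dotp y y *: x - dotp x y *: y).
rewrite !(dotpDl, dotpDr, dotpNl, dotpNr, dotpZl, dotpZr) (dotpC y x).
rewrite [X in 0 <= X](_ : _ = dotp y y * (dotp x x * dotp y y - dotp x y ^+ 2)); last by ring.
by rewrite pmulr_rge0// subr_ge0.
Qed.

Lemma enorm_ge0 x : 0 <= enorm x. Proof. exact: sqrtr_ge0. Qed.

Lemma sqr_enorm x : enorm x ^+ 2 = dotp x x.
Proof. by rewrite sqr_sqrtr// dotp_ge0. Qed.

Lemma enormZ (a : R) x : enorm (a *: x) = `|a| * enorm x.
Proof.
by rewrite /enorm dotpZl dotpZr mulrA -expr2 sqrtrM ?sqr_ge0// sqrtr_sqr.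
Qed.

Lemma norm_dotp_le x y : `|dotp x y| <= enorm x * enorm y.
Proof.
rewrite -ler_sqr ?nnegrE ?mulr_ge0 ?enorm_ge0// real_normK ?num_real//.
by rewrite exprMn !sqr_enorm sqr_dotp_le.
Qed.

Lemma enormD x y : enorm (x + y) <= enorm x + enorm y.
Proof.
rewrite -ler_sqr ?nnegrE ?addr_ge0 ?enorm_ge0// sqrrD !sqr_enorm.
rewrite dotpDl !dotpDr (dotpC y x).
have := le_trans (ler_norm _) (norm_dotp_le x y); rewrite mulr2n; lra.
Qed.

Lemma mx_norm_le_enorm x : `|x| <= enorm x.
Proof.
rewrite [leLHS]/Num.norm /= mx_normrE; apply: bigmax_le => [|[i j] _ /=].
  exact: enorm_ge0.
rewrite -ler_sqr ?nnegrE ?enorm_ge0// real_normK ?num_real// sqr_enorm.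
by rewrite (ord1 i) coord_sqr_le.
Qed.

(** Lagrange reduction: completing the square in one variable leaves a form that
    no longer involves it; the lower bound survives, because the reduced form
    at [x] is the minimum of the old one over that variable. *)
Lemma positive_form_sum_squares (alpha : R) S : 0 < alpha -> S^T = S ->
  (forall x, alpha * dotp x x <= dotp (x *m S) x) ->
  exists cs : seq 'rV[R]_N, S = \sum_(c <- cs) c^T *m c.
Proof.
move=> a0 symS posS.
suff H n k : (k + n = N)%N -> forall T : 'M[R]_N, T^T = T ->
    (forall i j : 'I_N, (i < k)%N -> T i j = 0) ->
    (forall x, alpha * (\sum_(i < N | (k <= i)%N) x 0 i ^+ 2) <= dotp (x *m T) x) ->
    exists cs : seq 'rV[R]_N, T = \sum_(c <- cs) c^T *m c.
  apply: (H N 0%N) => // x; apply: le_trans _ (posS x).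
elim: n k => [|n IH] k kN T symT zT posT.
  exists [::]; rewrite big_nil; apply/matrixP => i j; rewrite mxE; apply: zT.
  by rewrite -(addn0 k) kN.
have kltN : (k < N)%N by rewrite -kN addnS ltnS leq_addr.
pose o := Ordinal kltN; pose d : 'rV[R]_N := delta_mx 0 o; pose v := row o T.
have Tsym (i j : 'I_N) : T i j = T j i by rewrite -[in LHS]symT mxE.
have dT : d *m T = v by rewrite /v rowE.
have xTd x : (x *m T) 0 o = dotp x v.
  by rewrite mxE; apply: eq_bigr => j _; rewrite [v _ _]mxE Tsym.
set s := T o o; have s0 : 0 < s.
  have := posT d; rewrite dT dotp_delta mxE -/s; apply: lt_le_trans.
  rewrite pmulr_rgt0// (bigD1 o)//= mxE !eqxx expr1n ltr_wpDr//.
  by apply: sumr_ge0 => i _; rewrite sqr_ge0.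
pose T' := T - s^-1 *: (v^T *m v).
have T'E x : dotp (x *m T') x = dotp (x *m T) x - s^-1 * dotp x v ^+ 2.
  rewrite mulmxBr dotpDl dotpNl -scalemxAr dotpZl mulmxA.
  suff -> : x *m v^T *m v = dotp x v *: v by rewrite dotpZl (dotpC v) expr2.
  apply/rowP => j; rewrite !mxE big_ord1 mxE; congr (_ * _); last by rewrite mxE.
  by apply: eq_bigr => i _; rewrite mxE.
have T'ij : forall i j, T' i j = T i j - s^-1 * (T o i * T o j).
  by move=> i j; rewrite !mxE big_ord1 !mxE.
have [||||cs csE] := IH k.+1 _ T'.
- by rewrite addSnnS.
- apply/matrixP => i j; rewrite mxE !T'ij Tsym; ring.
- move=> i j; rewrite ltnS leq_eqVlt => /orP[/eqP ik|ik]; rewrite T'ij.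
    have -> : i = o by apply: val_inj.
    by rewrite -/s mulrA mulVf ?gt_eqF// mul1r subrr.
  by rewrite (zT i j ik) [T o i]Tsym (zT i o ik) mul0r mulr0 subrr.
- move=> x; pose y := x - (s^-1 * dotp x v) *: d.
  have <- : dotp (y *m T) y = dotp (x *m T') x.
    rewrite T'E /y mulmxBl -scalemxAl dT.
    rewrite !(dotpDl, dotpDr, dotpNl, dotpNr, dotpZl, dotpZr) !dotp_delta.
    rewrite xTd (dotpC v x) [v 0 o]mxE -/s.
    by field; rewrite gt_eqF.
  apply: le_trans _ (posT y); rewrite ler_pM2l//.
  rewrite [leRHS](bigD1 o)//= -[leLHS]add0r lerD ?sqr_ge0//.
  rewrite [leLHS](eq_bigl (fun i : 'I_N => (k <= i)%N && (i != o))); last first.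
    by move=> i; rewrite ltn_neqAle andbC eq_sym.
  apply: ler_sum => i /andP[_ io].
  by rewrite /y !mxE eqxx/= (negbTE io) mulr0 subr0.
have sq0 : 0 <= s^-1 by rewrite invr_ge0 ltW.
exists ((Num.sqrt s^-1 *: v) :: cs); rewrite big_cons -csE /T'.
have -> : (Num.sqrt s^-1 *: v)^T = Num.sqrt s^-1 *: v^T.
  by apply/matrixP => i j; rewrite !mxE.
by rewrite -scalemxAl -scalemxAr scalerA -expr2 sqr_sqrtr// addrC subrK.
Qed.

End DotProduct.

(** * Parabolic equations along lines *)

Lemma continuous_pair (X U W : topologicalType) (f : X -> U) (g : X -> W) x :
  {for x, continuous f} -> {for x, continuous g} ->
  {for x, continuous (fun y => (f y, g y))}.
Proof.
move=> cf cg.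
exact: (cvg_pair (FG := nbhs_filter (f x)) (FH := nbhs_filter (g x)) cf cg).
Qed.

Lemma continuous_slice (R : realType) (V : normedModType R) (w : R -> V -> R) t x :
  continuous (fun z : R * V => w z.1 z.2) -> {for x, continuous (w t)}.
Proof.
move=> cw; apply: (@continuous_comp _ _ _ (fun y : V => (t, y)) (fun z => w z.1 z.2) x).
  by apply: continuous_pair; [exact: cvg_cst|exact: cvg_id].
exact: cw.
Qed.

(** The equation [u_t = sum_c d_c^2 u + d_q u + g]. Writing the second-order part
    as a sum of second derivatives along lines reduces all differentiation to one
    variable; leaving the reaction term in the source [g] makes the notion linear
    and invariant under translations. *)
Definition linear_parabolic (R : realType) (N : nat) (cs : seq 'rV[R]_N) (q : 'rV[R]_N)
    (g : R -> 'rV[R]_N -> R) (u : R -> 'rV[R]_N -> R) : Prop :=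
  continuous (fun z : R * 'rV[R]_N => u z.1 z.2) /\
  forall t x, exists ut (d1 d2 : 'rV[R]_N -> R),
    [/\ jet1 (fun h => u (t + h) x) ut,
        forall c, jet2 (fun h => u t (x + h *: c)) (d1 c) (d2 c) &
        ut = \sum_(c <- cs) d2 c + d1 q + g t x].

Section LinearParabolic.
Variables (R : realType) (N : nat).
Local Notation V := 'rV[R]_N.
Implicit Types (cs : seq V) (q x : V) (g u v : R -> V -> R).

Lemma linear_parabolicB cs q g1 g2 u v :
  linear_parabolic cs q g1 u -> linear_parabolic cs q g2 v ->
  linear_parabolic cs q (fun t x => g1 t x - g2 t x) (fun t x => u t x - v t x).
Proof.
move=> [cu Hu] [cv Hv]; split=> [z|t x]; first by apply: cvgB; [exact: cu|exact: cv].
have [ut [d1 [d2 [ju jd e]]]] := Hu t x.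
have [ut' [d1' [d2' [ju' jd' e']]]] := Hv t x.
exists (ut - ut'), (fun c => d1 c - d1' c), (fun c => d2 c - d2' c); split.
- exact: jet1B.
- by move=> c; exact: jet2B.
- by rewrite e e' big_split/= sumrN; ring.
Qed.

Lemma linear_parabolic_shift cs q g u s y :
  linear_parabolic cs q g u ->
  linear_parabolic cs q (fun t x => g (t + s) (x + y)) (fun t x => u (t + s) (x + y)).
Proof.
move=> [cu Hu]; split=> [z|t x].
  apply: (@continuous_comp _ _ _ (fun z : R * V => (z.1 + s, z.2 + y))
     (fun z => u z.1 z.2) z); last exact: cu.
  apply: continuous_pair; apply: cvgD; do ?exact: cvg_cst.
    exact: cvg_fst.
  exact: cvg_snd.
have [ut [d1 [d2 [ju jd e]]]] := Hu (t + s) (x + y).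
exists ut, d1, d2; split=> //.
- by move: ju; congr jet1; apply/funext => h; rewrite addrAC.
- by move=> c; move: (jd c); congr jet2; apply/funext => h; rewrite addrAC.
Qed.

Lemma jet1_sum (I : Type) (r : seq I) (k : I -> R -> R) (d : I -> R) :
  (forall i, jet1 (k i) (d i)) ->
  jet1 (fun h => \sum_(i <- r) k i h) (\sum_(i <- r) d i).
Proof.
move=> jk; elim: r => [|i r IH].
  rewrite big_nil => e e0; exists 1 => // h _.
  by rewrite !big_nil mul0r !subr0 normr0 mulr_ge0// ltW.
rewrite big_cons; have := jet1D (jk i) IH; congr jet1; apply/funext => h.
by rewrite big_cons.
Qed.

Section Classical.
Variables (A : 'M[R]_N) (q : V) (F : V -> R -> R) (u : R -> V -> R).
Hypothesis u_sol : classical_solution A q F u.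

Let e i : V := delta_mx 0 i.
Let H t i j := partial j (partial i (u t)).

Let cu1 t i x : {for x, continuous (partial i (u t))}.
Proof.
have [[_ _ _ [_ _ c _]] _] := u_sol.
exact: (continuous_slice (w := fun t => partial i (u t))).
Qed.

Let cu2 t i j x : {for x, continuous (H t i j)}.
Proof.
have [[_ _ _ [_ _ _ c]] _] := u_sol.
exact: (@continuous_slice _ _ (fun t => H t i j) t x (c i j)).
Qed.

Let ju1 t i x : jet1 (fun h => u t (x + h *: e i)) (partial i (u t) x).
Proof.
have [[_ d _ _] _] := u_sol; apply/jet1_is_derive/derivableP; exact: d.
Qed.

Let ju2 t i j x : jet1 (fun h => partial i (u t) (x + h *: e j)) (H t i j x).
Proof.
have [[_ _ d _] _] := u_sol; apply/jet1_is_derive/derivableP; exact: d.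
Qed.

Let H_sym t i j x : H t i j x = H t j i x.
Proof.
by apply: (@schwarz _ _ (u t) (partial i (u t)) (partial j (u t)) _ _ (e i) (e j)).
Qed.

Let row_sum_e (c : V) : c = \sum_i c 0 i *: e i.
Proof. exact: row_sum_delta. Qed.

Let D1 t x (c : V) := \sum_i c 0 i * partial i (u t) x.
Let D2 t x (c : V) := \sum_i \sum_j c 0 i * c 0 j * H t i j x.

Let jet_D1 t x c : jet1 (fun h => u t (x + h *: c)) (D1 t x c).
Proof.
have := @chain_rule _ _ _ (index_enum 'I_N) (fun i => c 0 i) e (u t) (fun i => partial i (u t)) x
  (fun i y => ju1 t i y) (fun i => @cu1 t i x).
by rewrite -row_sum_e.
Qed.

Let jet_D2 t x c : jet2 (fun h => u t (x + h *: c)) (D1 t x c) (D2 t x c).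
Proof.
have := @taylor_young _ (fun h => u t (x + h *: c)) (fun h => D1 t (x + h *: c) c)
  (D2 t x c).
rewrite scale0r addr0; apply.
- move=> h0; move: (jet_D1 t (x + h0 *: c) c); congr jet1; apply/funext => h.
  by rewrite scalerDl addrA.
- apply: jet1_sum => i; rewrite (eq_bigr (fun j => c 0 i * (c 0 j * H t i j x))); last first.
    by move=> j _; rewrite mulrA.
  rewrite -mulr_sumr; apply: jet1Z.
  have := @chain_rule _ _ _ (index_enum 'I_N) (fun i => c 0 i) e (partial i (u t)) (H t i) x
    (fun j y => ju2 t i j y) (fun j => @cu2 t i j x).
  by rewrite -row_sum_e.
Qed.

Let divergenceE t x : divergence (fun y => gradient (u t) y *m A^T) x =
  \sum_i \sum_j A i j * H t i j x.
Proof.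
apply: eq_bigr => i _; rewrite /partial.
have -> : (fun y => (gradient (u t) y *m A^T) 0 i) =
   (fun y => \sum_j A i j * partial j (u t) y).
  by apply/funext => y; rewrite mxE; apply: eq_bigr => j _; rewrite !mxE mulrC.
have [_ ->] // : is_derive x (e i) (fun y => \sum_j A i j * partial j (u t) y)
  (\sum_j A i j * H t i j x).
apply/jet1_is_derive; apply: jet1_sum => j; rewrite H_sym.
by apply: jet1Z; exact: ju2.
Qed.

(** The sum of the second derivatives along the [c] is the symmetric part of [A]
    contracted with the Hessian; the antisymmetric part contributes nothing,
    because the Hessian is symmetric. *)
Lemma classical_solution_linear_parabolic cs :
  2^-1 *: (A + A^T) = \sum_(c <- cs) c^T *m c ->
  linear_parabolic cs q (fun t x => F x (u t x)) u.
Proof.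
move=> csE; have [[dt _ _ [cu _ _ _]] eqn] := u_sol; split=> // t x.
exists (derive1 (u ^~ x) t), (D1 t x), (D2 t x); split=> //.
- have /jet1_is_derive : is_derive t 1 (u ^~ x) (derive1 (u ^~ x) t).
    by rewrite derive1E; apply: derivableP; exact: dt.
  by congr jet1; apply/funext => h; rewrite [_%:A]mulr1.
rewrite eqn divergenceE; congr (_ + _ + _); last first.
  by apply: eq_bigr => i _; rewrite mxE.
have -> : \sum_(c <- cs) D2 t x c = \sum_i \sum_j (2^-1 *: (A + A^T)) i j * H t i j x.
  rewrite csE exchange_big/=; apply: eq_bigr => i _.
  rewrite exchange_big/=; apply: eq_bigr => j _.
  rewrite summxE mulr_suml; apply: eq_bigr => c _.
  by rewrite mxE big_ord1 mxE.
have sw : \sum_i \sum_j A i j * H t i j x = \sum_i \sum_j A j i * H t i j x.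
  rewrite exchange_big/=; apply: eq_bigr => i _; apply: eq_bigr => j _.
  by rewrite H_sym.
transitivity (2^-1 * (\sum_i \sum_j A i j * H t i j x + \sum_i \sum_j A j i * H t i j x)).
  by rewrite -sw; field.
rewrite -big_split/= mulr_sumr; apply: eq_bigr => i _.
rewrite -big_split/= mulr_sumr; apply: eq_bigr => j _.
by rewrite !mxE; ring.
Qed.

End Classical.

End LinearParabolic.

(** * Almost minima and their derivatives *)

(** Points on one side suffice: at the final time of a cylinder, a minimum can
    only be compared with earlier times. *)
Lemma jet1_le0 (R : realType) (k : R -> R) d : jet1 k d ->
  (exists2 rho, 0 < rho & forall h, 0 < h < rho -> k 0 <= k (- h)) -> d <= 0.
Proof.
move=> jk [rho rho0 kmin]; apply/ler_addgt0Pr => e e0; rewrite add0r.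
have [r r0 H] := jk _ e0.
pose h := Num.min rho r / 2.
have h0 : 0 < h by rewrite divr_gt0// lt_min rho0.
have : h < Num.min rho r.
  by rewrite ltr_pdivrMr// ltr_pMr ?ltr1n// lt_min rho0.
rewrite lt_min => /andP[h1 h2].
have := H (- h); rewrite normrN expr1 (gtr0_norm h0) => /(_ h2).
have := kmin h; rewrite h0 h1 => /(_ isT) km /(le_trans (ler_norm _)).
rewrite mulrN opprK => H'; rewrite -(ler_pM2r h0).
by lra.
Qed.

Lemma jet2_min (R : realType) (k : R -> R) d1 d2 : jet2 k d1 d2 ->
  (exists2 rho, 0 < rho & forall h, `|h| < rho -> k 0 <= k h) -> d1 = 0 /\ 0 <= d2.
Proof.
move=> jk [rho rho0 kmin].
have d10 : d1 = 0.
  have j1 := jet2_jet1 jk.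
  apply/eqP; rewrite eq_le; apply/andP; split.
    apply: (jet1_le0 j1); exists rho => // h /andP[h0 hr].
    by apply: kmin; rewrite normrN gtr0_norm.
  rewrite -oppr_le0; apply: (jet1_le0 (jet1_opp j1)); exists rho => // h /andP[h0 hr].
  by rewrite oppr0 opprK; apply: kmin; rewrite gtr0_norm.
split=> //; rewrite -oppr_le0; apply/ler_addgt0Pr => e e0; rewrite add0r.
have e2 : 0 < e / 2 by rewrite divr_gt0.
have [r r0 H] := jk _ e2.
pose h := Num.min rho r / 2.
have h0 : 0 < h by rewrite divr_gt0// lt_min rho0.
have : h < Num.min rho r.
  by rewrite ltr_pdivrMr// ltr_pMr ?ltr1n// lt_min rho0.
rewrite lt_min -[h in h < rho](gtr0_norm h0) -[h in h < r](gtr0_norm h0).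
move=> /andP[/kmin km /H /(le_trans (ler_norm _))].
rewrite d10 mul0r subr0 (gtr0_norm h0) => H'.
have hh : 0 < h ^+ 2 by rewrite exprn_gt0.
by rewrite -(ler_pM2r hh); lra.
Qed.

Lemma continuous_sumr (R : realType) (X : topologicalType) (I : Type) (r : seq I)
  (f : I -> X -> R) x : (forall i, {for x, continuous (f i)}) ->
  {for x, continuous (fun y => \sum_(i <- r) f i y)}.
Proof.
move=> cf; elim: r => [|i r IH].
  have -> : (fun y => \sum_(i <- [::]) f i y) = fun=> 0.
    by apply/funext => y; rewrite big_nil.
  exact: cvg_cst.
have -> : (fun y => \sum_(j <- i :: r) f j y) = (fun y => f i y + \sum_(j <- r) f j y).
  by apply/funext => y; rewrite big_cons.
by apply: continuousD; [exact: cf|exact: IH].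
Qed.

Lemma continuous_dotp (R : realType) (N : nat) (X : topologicalType)
    (f g : X -> 'rV[R]_N) x :
  {for x, continuous f} -> {for x, continuous g} ->
  {for x, continuous (fun y => dotp (f y) (g y))}.
Proof.
move=> cf cg; apply: continuous_sumr => i.
apply: continuousM.
  apply: (continuous_comp (f := f) (g := fun M : 'rV[R]_N => M 0 i)) => //.
  exact: coord_continuous.
apply: (continuous_comp (f := g) (g := fun M : 'rV[R]_N => M 0 i)) => //.
exact: coord_continuous.
Qed.

Section Projections.
Variables (R : realType) (V : topologicalType) (p : R * V * R).

Lemma continuous_time : {for p, continuous (fun p : R * V * R => p.1.1)}.
Proof.
by apply: (@continuous_comp _ _ _ (fst : R * V * R -> R * V) (fst : R * V -> R));
  exact: cvg_fst.
Qed.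

Lemma continuous_space : {for p, continuous (fun p : R * V * R => p.1.2)}.
Proof.
by apply: (@continuous_comp _ _ _ (fst : R * V * R -> R * V) (snd : R * V -> V));
  [exact: cvg_fst|exact: cvg_snd].
Qed.

End Projections.

Section AlmostMinimum.
Variables (R : realType) (N : nat).
Local Notation V := 'rV[R]_N.
Local Notation E := (R * V * R)%type.

Let sqnorm (p : E) : R := p.1.1 ^+ 2 + dotp p.1.2 p.1.2 + p.2 ^+ 2.

Let continuous_sqnorm : continuous sqnorm.
Proof.
move=> p.
have c1 := @continuous_time _ _ p; have c2 := @continuous_space _ _ p.
have c3 : {for p, continuous (fun p : E => p.2)} by exact: cvg_snd.
rewrite /continuous_at /sqnorm; apply: cvgD; first apply: cvgD.
- have -> : (fun p : E => p.1.1 ^+ 2) = (fun p : E => p.1.1 * p.1.1) by [].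
  exact: cvgM.
- exact: (@continuous_dotp _ _ _ (fun p : E => p.1.2) (fun p : E => p.1.2) p c2 c2).
- have -> : (fun p : E => p.2 ^+ 2) = (fun p : E => p.2 * p.2) by [].
  exact: cvgM.
Qed.

Let compact_sqnorm (S : set E) (C : R) : closed S ->
  compact (S `&` [set p | sqnorm p <= C]).
Proof.
move=> Scl.
pose M := Num.sqrt `|C|.
have enormM (x : V) : (enorm x <= M) = (dotp x x <= `|C|).
  by rewrite -ler_sqr ?nnegrE ?enorm_ge0 ?sqrtr_ge0// sqr_enorm sqr_sqrtr.
have cK : compact ((`[- M, M] `*` [set x : V | enorm x <= M]) `*` `[- M, M] : set E).
  apply: compact_setX; last exact: segment_compact.
  apply: compact_setX; first exact: segment_compact.
  apply: bounded_closed_compact.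
    exists M; split; first exact: num_real.
    move=> r Mr x /= xM; rewrite (le_trans (mx_norm_le_enorm _))//.
    by rewrite (le_trans xM)// ltW.
  have -> : [set x : V | enorm x <= M] = (fun x => dotp x x) @^-1` [set r | r <= `|C|].
    by apply/seteqP; split => x /=; rewrite enormM.
  have /continuous_closedP H : continuous (fun x : V => dotp x x).
    by move=> x; apply: continuous_dotp; exact: cvg_id.
  exact: (H _ (@closed_le _ `|C|)).
apply: subclosed_compact cK _.
  apply: closedI => //; have /continuous_closedP H := continuous_sqnorm.
  exact: (H _ (@closed_le _ C)).
move=> [[t x] r] /= [_]; rewrite /sqnorm/= => sC.
have sqM (y : R) : y ^+ 2 <= C -> - M <= y <= M.
  move=> yC; rewrite -ler_norml -ler_sqr ?nnegrE ?sqrtr_ge0//.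
  by rewrite real_normK ?num_real// sqr_sqrtr// (le_trans yC)// ler_norm.
have := sqr_ge0 t; have := sqr_ge0 r; have := dotp_ge0 x => x0 r0 t0.
split; [split|]; rewrite /= ?in_itv/=.
- by apply: sqM; lra.
- by rewrite enormM; apply: le_trans (ler_norm _); lra.
- by apply: sqM; lra.
Qed.

(** On an unbounded set a function need not attain its minimum, but it does after
    the addition of [gam |p|^2] with [gam > 0]. At the minimum the penalty
    [gam |p|^2] is bounded independently of small [gam], so its first derivatives, of
    the order of [gam |p|], and its second derivatives, of the order of [gam], tend
    to [0] with [gam]. *)
Lemma almost_minimum (S : R -> V -> R -> Prop) (w : R -> V -> R -> R)
    (m K eps : R) t0 x0 r0 :
  closed [set p : E | S p.1.1 p.1.2 p.2] ->
  continuous (fun p : E => w p.1.1 p.1.2 p.2) ->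
  (forall t x r, S t x r -> m <= w t x r) -> S t0 x0 r0 -> 0 < eps ->
  exists t x r, [/\ S t x r, w t x r <= w t0 x0 r0 + eps,
    forall d, jet1 (fun h => w (t + h) x r) d ->
      (exists2 rho, 0 < rho & forall h, 0 < h < rho -> S (t - h) x r) -> d <= eps,
    forall c d1 d2, dotp c c <= K -> jet2 (fun h => w t (x + h *: c) r) d1 d2 ->
      (exists2 rho, 0 < rho & forall h, `|h| < rho -> S t (x + h *: c) r) ->
      `|d1| <= eps /\ - eps <= d2 &
    forall d1 d2, jet2 (fun h => w t x (r + h)) d1 d2 ->
      (exists2 rho, 0 < rho & forall h, `|h| < rho -> S t x (r + h)) -> - eps <= d2].
Proof.
move=> Scl cw wm S0 e0.
pose p0 : E := (t0, x0, r0); pose W (p : E) := w p.1.1 p.1.2 p.2.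
pose L := `|K| + 1; have L1 : 1 <= L by rewrite lerDr.
have KL : K <= L by rewrite (le_trans (ler_norm K))// lerDl.
have n0 : 0 <= sqnorm p0 by rewrite !addr_ge0 ?sqr_ge0 ?dotp_ge0.
(* a bound for the penalty at the minimum *)
pose C := W p0 - m + 1.
have C0 : 0 < C by rewrite ltr_wpDl// subr_ge0; exact: (wm t0 x0 r0).
have [gam [gam0 gamp0 gam1 gamL gamC]] : exists gam : R, [/\ 0 < gam,
    gam * sqnorm p0 <= eps, gam * sqnorm p0 <= 1, 2 * gam * L <= eps &
    4 * gam * C * L <= eps ^+ 2].
  pose D := sqnorm p0 + 2 * L + 4 * C * L + 1.
  have CL : 0 <= 4 * C * L by rewrite !mulr_ge0 ?(ltW C0)// (le_trans _ L1).
  have D0 : 0 < D by rewrite /D; lra.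
  have e20 : 0 < eps ^+ 2 by rewrite exprn_gt0.
  pose G := Num.min (Num.min eps 1) (eps ^+ 2).
  have G0 : 0 < G by rewrite !lt_min e0 ltr01.
  have : G <= G by [].
  rewrite {2}/G !le_min => /andP[/andP[G1 G2] G3].
  have key y : 0 <= y -> y <= D -> G / D * y <= G.
    by move=> y0 yD; rewrite -mulrA ler_piMr ?(ltW G0)// mulrC ler_pdivrMr// mul1r.
  exists (G / D); split.
  - by rewrite divr_gt0.
  - by apply: le_trans G1; apply: key => //; rewrite /D; lra.
  - by apply: le_trans G2; apply: key => //; rewrite /D; lra.
  - apply: le_trans G1; rewrite (_ : 2 * (G / D) * L = G / D * (2 * L)); last by ring.
    by apply: key; rewrite ?/D; lra.
  - apply: le_trans G3; rewrite (_ : 4 * (G / D) * C * L = G / D * (4 * C * L)); last by ring.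
    by apply: key; rewrite ?/D; lra.
pose f p := W p + gam * sqnorm p.
pose Kset := [set p : E | S p.1.1 p.1.2 p.2] `&` [set p | sqnorm p <= C / gam].
have p0K : f p0 <= C + m by rewrite /f /C; lra.
have Kf p : S p.1.1 p.1.2 p.2 -> f p <= C + m -> sqnorm p <= C / gam.
  by move=> Sp; rewrite /f ler_pdivlMr// mulrC => fp; have := wm _ _ _ Sp; rewrite /W in fp; lra.
have [||| p /[!inE] -[Sp pC] pmin] := @compact_EVT_min _ _ f Kset.
- by exists p0; split=> //; exact: Kf.
- exact: compact_sqnorm.
- apply: continuous_subspaceT => p; apply: continuousD; first exact: cw.
  by apply: continuousM; [exact: cvg_cst|exact: continuous_sqnorm].
have {}pmin z : S z.1.1 z.1.2 z.2 -> f p <= f z.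
  move=> Sz; have [zC|zC] := leP (f z) (C + m).
    by apply: pmin; rewrite inE; split=> //; exact: Kf.
  have := pmin p0; rewrite inE => H; apply: (le_trans (H _)).
    by split=> //; exact: Kf.
  by rewrite (le_trans p0K)// ltW.
case: p Sp pC pmin => -[t x] r /= Sp pC pmin.
rewrite /= ler_pdivlMr// in pC.
have small (y : R) : y ^+ 2 <= sqnorm (t, x, r) * L -> `|2 * gam * y| <= eps.
  move=> yL; rewrite -ler_sqr ?nnegrE ?(ltW e0)// real_normK ?num_real//.
  apply: le_trans gamC.
  have -> : (2 * gam * y) ^+ 2 = 4 * gam * (gam * y ^+ 2) by ring.
  rewrite -!mulrA ler_pM2l// ler_pM2l//.
  apply: (@le_trans _ _ (gam * (sqnorm (t, x, r) * L))); first by rewrite ler_pM2l.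
  by rewrite mulrA ler_wpM2r ?(le_trans _ L1)// mulrC.
have L0 : 0 <= L by rewrite (le_trans _ L1).
have t2 := sqr_ge0 t; have r2 := sqr_ge0 r; have x2 := dotp_ge0 x.
exists t, x, r; split=> //.
- have := pmin p0 S0; rewrite /f /W/=.
  have : 0 <= gam * sqnorm (t, x, r) by rewrite mulr_ge0 ?(ltW gam0)// !addr_ge0.
  by move=> a b; move: gamp0; lra.
- move=> d jd [rho rho0 Srho].
  have jq : jet1 (fun h : R => gam * sqnorm (t + h, x, r)) (2 * gam * t).
    have /jet2_jet1 := jet2_poly3 (gam * sqnorm (t, x, r)) (2 * gam * t) gam 0 0.
    by congr jet1; apply/funext => h; rewrite /sqnorm/=; ring.
  have : d + 2 * gam * t <= 0.
    apply: (jet1_le0 (jet1D jd jq)); exists rho => // h hr.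
    rewrite addr0; have := pmin (t - h, x, r); apply.
    exact: Srho.
  have : `|2 * gam * t| <= eps.
    apply: small; rewrite -[leLHS]mulr1 /sqnorm/=.
    by apply: ler_pM => //; lra.
  by rewrite ler_norml => /andP[]; lra.
- move=> c d1 d2 cK jd [rho rho0 Srho].
  have jq : jet2 (fun h : R => gam * sqnorm (t, x + h *: c, r))
      (2 * gam * dotp x c) (2 * (gam * dotp c c)).
    have := jet2_poly3 (gam * sqnorm (t, x, r)) (2 * gam * dotp x c) (gam * dotp c c) 0 0.
    congr jet2; apply/funext => h; rewrite /sqnorm/=.
    by rewrite !(dotpDl, dotpDr, dotpZl, dotpZr) (dotpC c x); ring.
  have [|d10 d20] := jet2_min (jet2D jd jq).
    exists rho => // h hr; rewrite scale0r addr0.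
    have := pmin (t, x + h *: c, r); apply; exact: Srho.
  split.
    have -> : d1 = - (2 * gam * dotp x c) by lra.
    rewrite normrN small// (le_trans (sqr_dotp_le _ _))//.
    by apply: ler_pM; rewrite ?dotp_ge0// ?(le_trans cK)// /sqnorm/=; lra.
  have : gam * dotp c c <= gam * L by rewrite ler_pM2l// (le_trans cK).
  by lra.
- move=> d1 d2 jd [rho rho0 Srho].
  have jq : jet2 (fun h : R => gam * sqnorm (t, x, r + h)) (2 * gam * r) (2 * gam).
    have := jet2_poly3 (gam * sqnorm (t, x, r)) (2 * gam * r) gam 0 0.
    by congr jet2; apply/funext => h; rewrite /sqnorm/=; ring.
  have [|_ d20] := jet2_min (jet2D jd jq).
    exists rho => // h hr; rewrite addr0.
    have := pmin (t, x, r + h); apply; exact: Srho.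
  have : 2 * gam * 1 <= 2 * gam * L by rewrite ler_pM2l// mulr_gt0.
  by lra.
Qed.

End AlmostMinimum.

(** * A Lipschitz bound for increments *)

Lemma jet2_cst (R : realType) (a : R) : jet2 (fun=> a) 0 0.
Proof.
have := jet2_poly3 a 0 0 0 0; rewrite mulr0; congr jet2; apply/funext => h.
by rewrite !mul0r !addr0.
Qed.

Lemma jet1_cst (R : realType) (a : R) : jet1 (fun=> a) 0.
Proof. exact: jet2_jet1 (jet2_cst a). Qed.

Lemma continuous_comp2 (R : realType) (V X : topologicalType) (u : R -> V -> R)
    (a : X -> R) (b : X -> V) p :
  continuous (fun z : R * V => u z.1 z.2) ->
  {for p, continuous a} -> {for p, continuous b} ->
  {for p, continuous (fun z => u (a z) (b z))}.
Proof.
move=> cu ca cb.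
apply: (continuous_comp (f := fun z => (a z, b z)) (g := fun z : R * V => u z.1 z.2)).
  exact: continuous_pair.
exact: cu.
Qed.

Lemma dotp_le_sum (R : realType) (N : nat) (cs : seq 'rV[R]_N) c : c \in cs ->
  dotp c c <= \sum_(b <- cs) dotp b b.
Proof.
elim: cs => // b cs IH; rewrite inE big_cons => /orP[/eqP <-|/IH cb].
  by rewrite lerDl; apply: sumr_ge0 => i _; exact: dotp_ge0.
by rewrite (le_trans cb)// lerDr dotp_ge0.
Qed.

Lemma sumr_le_size (R : realType) (T : eqType) (cs : seq T) (f : T -> R) (a : R) :
  (forall c, c \in cs -> f c <= a) -> \sum_(c <- cs) f c <= (size cs)%:R * a.
Proof.
elim: cs => [|c cs IH] fa; first by rewrite big_nil mul0r.
rewrite big_cons -natr1 mulrDl mul1r addrC lerD ?fa ?inE ?eqxx// IH// => b bc.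
by rewrite fa// inE bc orbT.
Qed.

Section Lipschitz.
Variables (R : realType) (N : nat).
Local Notation V := 'rV[R]_N.

(** The increment [u(x + r c) - u(x - r c)], seen as a function of [(t, x, r)],
    has the same second derivative in [r] as in the direction [c] of [x]. Trading
    one for the other gives a parabolic equation which is nondegenerate in [r],
    and the concave function [(2 U + Lam) r - Lam r^2], with [2 Lam = G + 1], is a
    strict supersolution of it which dominates the increment at [r = 0] and at
    [r = 1]. *)
Lemma increment_le (cs : seq V) (q c : V) (g u : R -> V -> R) (U G : R) :
  linear_parabolic (c :: cs) q g u -> (forall t x, `|u t x| <= U) -> 0 <= G ->
  (forall t x (r : R), 0 <= r <= 1 -> g t (x + r *: c) - g t (x - r *: c) <= G) ->
  forall t x (r : R), 0 <= r <= 1 ->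
    u t (x + r *: c) - u t (x - r *: c) <= (2 * U + (G + 1) / 2) * r.
Proof.
move=> [cu Hu] uU G0 gG t0 x0 r0 r01.
pose Lam := (G + 1) / 2; rewrite -/Lam.
have Lam0 : 0 < Lam by rewrite divr_gt0// ltr_wpDl.
pose w t x r := (2 * U + Lam) * r - Lam * r ^+ 2 - (u t (x + r *: c) - u t (x - r *: c)).
suff w0 : 0 <= w t0 x0 r0.
  by move: w0; rewrite /w; have := mulr_ge0 (ltW Lam0) (sqr_ge0 r0); lra.
have U0 : 0 <= U := le_trans (normr_ge0 _) (uU 0 0).
rewrite leNgt; apply/negP => wneg.
pose n : R := (size cs)%:R; have n0 : 0 <= n by rewrite ler0n.
pose eps := Num.min ((n + 4)^-1) (- w t0 x0 r0 / 2).
have eps0 : 0 < eps.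
  by rewrite lt_min invr_gt0 divr_gt0 ?oppr_gt0// andbT ltr_wpDl.
have epsn : eps * (n + 4) <= 1.
  have n4 : 0 < n + 4 by lra.
  by rewrite -ler_pdivlMr// mul1r ge_min lexx.
have epsw : eps <= - w t0 x0 r0 / 2 by rewrite ge_min lexx orbT.
have S_closed : closed [set p : R * V * R | 0 <= p.2 <= 1].
  have /continuous_closedP H : continuous (snd : R * V * R -> R) by move=> p; exact: cvg_snd.
  have := closedI (H _ (@closed_ge _ 0)) (H _ (@closed_le _ 1)).
  by congr closed; apply/seteqP; split => p /=; [case=> -> ->|case/andP].
have w_cont : continuous (fun p : R * V * R => w p.1.1 p.1.2 p.2).
  move=> p; have c1 := @continuous_time _ _ p; have c2 := @continuous_space _ _ p.
  have c3 : {for p, continuous (fun p : R * V * R => p.2)} by exact: cvg_snd.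
  have c4 : {for p, continuous (fun p : R * V * R => p.2 *: c)}.
    by apply: cvgZ; [exact: c3|exact: cvg_cst].
  apply: cvgB; first apply: cvgB.
  + by apply: cvgM; [exact: cvg_cst|exact: c3].
  + by apply: cvgM; [exact: cvg_cst|apply: cvgM; exact: c3].
  + apply: cvgB.
      by apply: (continuous_comp2 cu c1); apply: cvgD; [exact: c2|exact: c4].
    by apply: (continuous_comp2 cu c1); apply: cvgB; [exact: c2|exact: c4].
have w_ge t x r : 0 <= r <= 1 -> - (2 * U) <= w t x r.
  move=> /andP[ra rb]; rewrite /w.
  have : 0 <= 2 * U * r + Lam * (r * (1 - r)).
    by rewrite addr_ge0// mulr_ge0 ?(ltW Lam0) ?mulr_ge0// subr_ge0.
  by have := uU t (x + r *: c); have := uU t (x - r *: c); rewrite !ler_norml; lra.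
have [t [x [r [Sr wr dt dx dr]]]] := @almost_minimum _ _ (fun _ _ r => 0 <= r <= 1) w
  (- (2 * U)) (\sum_(b <- q :: cs) dotp b b) eps t0 x0 r0
  S_closed w_cont w_ge r01 eps0.
have {}wr : w t x r < 0 by lra.
have r0' : r != 0.
  apply: contraTneq wr => ->; rewrite /w !scale0r subr0 addr0 -leNgt; lra.
have r1' : r != 1.
  apply: contraTneq wr => ->; rewrite /w !scale1r -leNgt.
  have := uU t (x + c); have := uU t (x - c); rewrite !ler_norml; lra.
have [ra rb] : 0 < r /\ r < 1.
  by move/andP: Sr => [? ?]; rewrite !lt_neqAle eq_sym r0' r1'.
have [ut1 [d1 [e1 [ju1 jd1 eq1]]]] := Hu t (x + r *: c).
have [ut2 [d2 [e2 [ju2 jd2 eq2]]]] := Hu t (x - r *: c).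
have every : exists2 rho : R, 0 < rho & forall h : R, `|h| < rho -> 0 <= r <= 1.
  by exists 1.
have Ht : ut2 - ut1 <= eps.
  apply: dt; last by exists 1.
  have := jet1B (jet1_cst ((2 * U + Lam) * r - Lam * r ^+ 2)) (jet1B ju1 ju2).
  by rewrite sub0r opprB; congr jet1.
have Hx b : b \in q :: cs -> `|d2 b - d1 b| <= eps /\ - eps <= e2 b - e1 b.
  move=> bq; apply: (dx b _ _ (dotp_le_sum bq) _ every).
  have := jet2B (jet2_cst ((2 * U + Lam) * r - Lam * r ^+ 2)) (jet2B (jd1 b) (jd2 b)).
  rewrite !sub0r !opprB; congr jet2; apply/funext => h.
  by rewrite /w; congr (_ - (u t _ - u t _)); rewrite addrAC.
have Hr : - eps <= - (2 * Lam) - (e1 c - e2 c).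
  apply: (dr (2 * U + Lam - 2 * Lam * r - (d1 c + d2 c))); last first.
    exists (Num.min r (1 - r)); first by rewrite lt_min ra subr_gt0.
    move=> h; rewrite lt_min !ltr_norml => /andP[/andP[? ?] /andP[? ?]].
    by apply/andP; split; lra.
  have := jet2B (jet2_poly3 ((2 * U + Lam) * r - Lam * r ^+ 2) (2 * U + Lam - 2 * Lam * r)
       (- Lam) 0 0) (jet2B (jd1 c) (jet2_opp (jd2 c))).
  rewrite opprK mulrN; congr jet2; apply/funext => h.
  rewrite /w (_ : x + (r + h) *: c = x + r *: c + h *: c); last first.
    by rewrite scalerDl addrA.
  rewrite (_ : x - (r + h) *: c = x - r *: c + - h *: c); first by ring.
  by rewrite scalerDl opprD scaleNr addrA.
have Hsum : \sum_(b <- cs) (e1 b - e2 b) <= n * eps.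
  by apply: sumr_le_size => b bc; have [|_] := Hx b; [rewrite inE bc orbT|lra].
have [|Hq _] := Hx q; first by rewrite inE eqxx.
have := gG t x r Sr.
move: eq1 eq2 Hsum Hq; rewrite !big_cons sumrB ler_norml => eq1 eq2 Hsum /andP[Hq1 Hq2].
by move: epsn; rewrite /Lam in Hr; lra.
Qed.

End Lipschitz.

(** * Spreading of positivity *)

Lemma jet1M (R : realType) (k g : R -> R) (d d' : R) : jet1 k d -> jet1 g d' ->
  jet1 (fun h => k h * g h) (k 0 * d' + g 0 * d).
Proof.
have E (f : R -> R) a : jet1 f a <-> is_derive (0 : R) (1 : R) f a.
  rewrite -is_derive_jet1; suff -> : (fun h => f (0 + h)) = f by [].
  by apply/funext => h; rewrite add0r.
by move=> /E jk /E jg; apply/E; exact: is_deriveM.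
Qed.

Lemma quadratic_le_near (R : realType) (a p s b : R) : a < b ->
  exists2 rho, 0 < rho & forall h, `|h| < rho -> a + 2 * h * p + h ^+ 2 * s <= b.
Proof.
move=> ab; have M0 : 0 < 2 * `|p| + `|s| + 1 by rewrite ltr_wpDl// addr_ge0// mulr_ge0.
exists (Num.min 1 ((b - a) / (2 * `|p| + `|s| + 1))).
  by rewrite lt_min ltr01 divr_gt0// subr_gt0.
move=> h; rewrite lt_min ltr_pdivlMr// => /andP[h1 h2].
rewrite -addrA -lerBrDl; apply: le_trans (ltW h2).
rewrite (le_trans (ler_norm _))// (le_trans (ler_normD _ _))//.
rewrite !mulrDr mulr1 -addrA lerD//.
  by rewrite !normrM (ger0_norm (ler0n _ _)) mulrCA mulrA.
rewrite -[leLHS]addr0 lerD// normrM ler_wpM2r// normrX expr2 ler_piMl// ltW//.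
Qed.

Section Spreading.
Variables (R : realType) (N : nat).
Local Notation V := 'rV[R]_N.

(** A quantitative strong maximum principle. The barrier is
    [mu exp (- lam (t - t1)) (r^2 - |X|^2)^2], where [X] is the position relative
    to a centre moving at constant velocity [b] from [y] at time [t1] to [x0] at
    time [t0]. Near the boundary of the moving ball the second derivatives of the
    square make it a subsolution; further inside, a large [lam] does. It lies
    below [z] at time [t1] and on the boundary of the ball, hence also at
    [(t0, x0)], where its value is bounded below in terms of the data. *)
Lemma positivity_spreads (cs : seq V) (q : V) (alpha K r T D kap : R) :
  0 < alpha -> (forall x, alpha * dotp x x <= \sum_(c <- cs) dotp x c ^+ 2) ->
  0 <= K -> 0 < r -> 0 <= D -> 0 < kap ->
  exists2 m, 0 < m & forall (g z : R -> V -> R), linear_parabolic cs q g z ->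
    (forall t x, 0 <= z t x) -> (forall t x, - (K * z t x) <= g t x) ->
    forall t1 t0 y x0, 1 <= t0 - t1 <= T -> enorm (x0 - y) <= D ->
      (forall x, enorm (x - y) <= r -> kap <= z t1 x) -> m <= z t0 x0.
Proof.
move=> alpha0 ell K0 r0 D0 kap0.
pose sig := \sum_(c <- cs) dotp c c.
pose M := 4 * (sig + r * enorm q + r * D) + 8 * alpha.
pose lam := K + M ^+ 2 / (16 * alpha * r ^+ 2).
have r2 : 0 < r ^+ 2 by rewrite exprn_gt0.
have lam0 : 0 <= lam.
  by rewrite addr_ge0// divr_ge0 ?sqr_ge0// !mulr_ge0// ltW.
exists (kap * expR (- lam * T)); first by rewrite mulr_gt0// expR_gt0.
move=> g z [cz Hz] z0 gz t1 t0 y x0 /andP[t1t0 t0T] x0y zy.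
have tt : 0 < t0 - t1 by rewrite (lt_le_trans ltr01).
pose b := (t0 - t1)^-1 *: (x0 - y).
have bD : enorm b <= D.
  rewrite enormZ gtr0_norm ?invr_gt0// (le_trans _ x0y)//.
  by rewrite ler_piMl ?enorm_ge0// invf_le1.
pose X t x : V := x - y - (t - t1) *: b.
pose mu := kap / r ^+ 4.
have mu0 : 0 < mu by rewrite divr_gt0// exprn_gt0.
pose psi t x := mu * expR (- lam * (t - t1)) * (r ^+ 2 - dotp (X t x) (X t x)) ^+ 2.
pose w t x (_ : R) := z t x - psi t x.
pose S t x (_ : R) : Prop := [/\ t1 <= t, t <= t0 & dotp (X t x) (X t x) <= r ^+ 2].
have X0 : X t0 x0 = 0.
  by rewrite /X /b scalerA divff ?gt_eqF// scale1r subrr.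
clearbody b.
have psi0 : psi t0 x0 = kap * expR (- lam * (t0 - t1)).
  by rewrite /psi X0 dotp0l /mu; field; rewrite gt_eqF.
suff : 0 <= w t0 x0 0.
  rewrite /w psi0 subr_ge0; apply: le_trans; rewrite ler_pM2l// ler_expR.
  by rewrite !mulNr lerN2 ler_wpM2l.
rewrite leNgt; apply/negP => wneg.
have S0 : S t0 x0 0 by split=> //; [lra|rewrite X0 dotp0l ltW].
have psi_le t x r' : S t x r' -> psi t x <= kap.
  move=> [tt1 tt0 Xr]; have -> : kap = mu * 1 * (r ^+ 2) ^+ 2.
    by rewrite /mu; field; rewrite gt_eqF.
  rewrite /psi; apply: ler_pM.
  - by rewrite mulr_ge0 ?(ltW mu0) ?expR_ge0.
  - exact: sqr_ge0.
  - by rewrite ler_pM2l// -expR0 ler_expR mulNr oppr_le0 mulr_ge0// subr_ge0.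
  - by apply: lerXn2r; rewrite ?nnegrE ?sqr_ge0 ?subr_ge0// gerBl dotp_ge0.
have cX p : {for p, continuous (fun p : R * V * R => X p.1.1 p.1.2)}.
  have c1 := @continuous_time _ _ p; have c2 := @continuous_space _ _ p.
  apply: cvgB; first by apply: cvgB; [exact: c2|exact: cvg_cst].
  by apply: cvgZr_tmp; apply: cvgB; [exact: c1|exact: cvg_cst].
have cXX : continuous (fun p : R * V * R => dotp (X p.1.1 p.1.2) (X p.1.1 p.1.2)).
  move=> p; pose Xp (p : R * V * R) := X p.1.1 p.1.2.
  exact: (@continuous_dotp _ _ _ Xp Xp p (cX p) (cX p)).
have S_closed : closed [set p : R * V * R | S p.1.1 p.1.2 p.2].
  have /continuous_closedP H1 : continuous (fun p : R * V * R => p.1.1).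
    by move=> p; exact: continuous_time.
  have /continuous_closedP H2 := cXX.
  have := closedI (closedI (H1 _ (@closed_ge _ t1)) (H1 _ (@closed_le _ t0)))
    (H2 _ (@closed_le _ (r ^+ 2))).
  by congr closed; apply/seteqP; split => p /=; [case=> -[? ?] ?|case].
have w_cont : continuous (fun p : R * V * R => w p.1.1 p.1.2 p.2).
  move=> p; have c1 := @continuous_time _ _ p; have c2 := @continuous_space _ _ p.
  apply: cvgB; first exact: (continuous_comp2 cz c1 c2).
  apply: cvgM.
    apply: cvgM; first exact: cvg_cst.
    apply: (continuous_comp (f := fun p : R * V * R => - lam * (p.1.1 - t1)) (g := @expR R)).
      by apply: cvgM; [exact: cvg_cst|apply: cvgB; [exact: c1|exact: cvg_cst]].
    exact: continuous_expR.
  have cd : {for p, continuous (fun p : R * V * R =>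
      r ^+ 2 - dotp (X p.1.1 p.1.2) (X p.1.1 p.1.2))}.
    by apply: cvgB; [exact: cvg_cst|exact: cXX].
  by apply: cvgM; exact: cd.
have w_ge t x r' : S t x r' -> - kap <= w t x r'.
  by move=> Sx; rewrite /w; have := psi_le _ _ _ Sx; have := z0 t x; lra.
pose n : R := (size cs)%:R; have n0 : 0 <= n by rewrite ler0n.
pose eta := 4 * alpha * r ^+ 2 * (mu * expR (- lam * T)).
have eta0 : 0 < eta.
  have E0 := expR_gt0 (- lam * T).
  by rewrite /eta; apply: mulr_gt0; apply: mulr_gt0 => //; apply: mulr_gt0.
pose eps := Num.min (eta / (n + 3)) (- w t0 x0 0 / 2).
have n3 : 0 < n + 3 by rewrite ltr_wpDl.
have eps0 : 0 < eps.
  by rewrite lt_min !divr_gt0 ?oppr_gt0.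
have epsn : eps * (n + 3) <= eta by rewrite -ler_pdivlMr// ge_min lexx.
have epsw : eps <= - w t0 x0 0 / 2 by rewrite ge_min lexx orbT.
have [t [x [r' [Sr wr dt dx _]]]] := @almost_minimum _ _ S w
  (- kap) (\sum_(b <- q :: cs) dotp b b) eps t0 x0 0 S_closed w_cont w_ge S0 eps0.
have {}wr : w t x r' < 0 by lra.
have [tt1 tt0 XX] := Sr.
have t1t : t1 < t.
  rewrite lt_neqAle tt1 andbT; apply: contraTneq wr => tE; rewrite -leNgt subr_ge0.
  apply: (le_trans (psi_le _ _ _ Sr)); rewrite -tE; apply: zy.
  move: XX; rewrite -tE /X subrr scale0r subr0 -sqr_enorm.
  by rewrite ler_sqr ?nnegrE ?enorm_ge0 ?(ltW r0).
have Xlt : dotp (X t x) (X t x) < r ^+ 2.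
  rewrite lt_neqAle XX andbT; apply: contraTneq wr => XE.
  by rewrite -leNgt subr_ge0 /psi XE subrr expr0n mulr0.
have [P XE] : exists P, X t x = P by exists (X t x).
rewrite XE in Xlt; pose d := r ^+ 2 - dotp P P; pose Ex := mu * expR (- lam * (t - t1)).
have d0 : 0 < d by rewrite subr_gt0.
have Ex0 : 0 < Ex by rewrite mulr_gt0 ?expR_gt0.
have XxE c h : X t (x + h *: c) = P + h *: c.
  by rewrite -XE; apply/rowP => i; rewrite !mxE; ring.
have XtE h : X (t + h) x = P - h *: b.
  by rewrite -XE; apply/rowP => i; rewrite !mxE; ring.
have jpx c : jet2 (fun h => psi t (x + h *: c)) (Ex * (- 4 * d * dotp P c))
    (Ex * (2 * (4 * dotp P c ^+ 2 - 2 * d * dotp c c))).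
  have := jet2Z Ex (jet2_poly3 (d ^+ 2) (- 4 * d * dotp P c) (4 * dotp P c ^+ 2 - 2 * d * dotp c c)
    (4 * dotp P c * dotp c c) (dotp c c ^+ 2)).
  congr jet2; apply/funext => h; rewrite /psi XxE -/Ex; congr (_ * _).
  rewrite !(dotpDl, dotpDr, dotpZl, dotpZr) (dotpC c P) /d; ring.
have jpt : jet1 (fun h => psi (t + h) x) (Ex * (4 * d * dotp P b - lam * d ^+ 2)).
  have j1 := jet2_jet1 (jet2_expR mu (- lam * (t - t1)) (- lam)).
  have j2 := jet2_jet1 (jet2_poly3 (d ^+ 2) (4 * d * dotp P b)
    (4 * dotp P b ^+ 2 - 2 * d * dotp b b)
    (- 4 * dotp P b * dotp b b) (dotp b b ^+ 2)).
  have := jet1M j1 j2; congr jet1; last by rewrite mul0r addr0 /Ex; ring.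
  apply/funext => h; rewrite /psi XtE.
  congr (_ * expR _ * _); first by ring.
  rewrite !(dotpDl, dotpDr, dotpNl, dotpNr, dotpZl, dotpZr) (dotpC b P) /d; ring.
have [zt [d1 [d2 [jzt jzx zeq]]]] := Hz t x.
have Ht : zt - Ex * (4 * d * dotp P b - lam * d ^+ 2) <= eps.
  apply: dt; first exact: jet1B.
  have [rho rho0 Hrho] := quadratic_le_near (dotp P b) (dotp b b) Xlt.
  exists (Num.min rho (t - t1)); first by rewrite lt_min rho0 subr_gt0.
  move=> h /andP[h0]; rewrite lt_min => /andP[hrho ht]; split; [lra|lra|].
  rewrite XtE scaleNr opprK; apply: le_trans (Hrho h _); last by rewrite gtr0_norm.
  rewrite !(dotpDl, dotpDr, dotpZl, dotpZr) (dotpC b P); lra.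
have Hx c : c \in q :: cs -> `|d1 c - Ex * (- 4 * d * dotp P c)| <= eps /\
    - eps <= d2 c - Ex * (2 * (4 * dotp P c ^+ 2 - 2 * d * dotp c c)).
  move=> cq; apply: (dx c _ _ (dotp_le_sum cq)); first exact: jet2B.
  have [rho rho0 Hrho] := quadratic_le_near (dotp P c) (dotp c c) Xlt.
  exists rho => // h hr; split=> //; rewrite XxE; apply: le_trans (Hrho h hr).
  rewrite !(dotpDl, dotpDr, dotpZl, dotpZr) (dotpC c P); lra.
have [|+ _] := Hx q; first by rewrite inE eqxx.
rewrite ler_norml => /andP[Hq _].
have Hsum : \sum_(c <- cs) (Ex * (2 * (4 * dotp P c ^+ 2 - 2 * d * dotp c c)) - d2 c) <= n * eps.
  by apply: sumr_le_size => c cc; have [|_] := Hx c; [rewrite inE cc orbT|lra].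
have sumE : \sum_(c <- cs) (Ex * (2 * (4 * dotp P c ^+ 2 - 2 * d * dotp c c)) - d2 c) =
   Ex * (8 * (\sum_(c <- cs) dotp P c ^+ 2) - 4 * d * sig) - \sum_(c <- cs) d2 c.
  rewrite sumrB -mulr_sumr; congr (_ * _ - _).
  by rewrite /sig !mulr_sumr -sumrB; apply: eq_bigr => c _; ring.
have Kz : - (K * (Ex * d ^+ 2)) <= g t x.
  apply: le_trans (gz t x); rewrite lerN2 ler_wpM2l//.
  by move: wr; rewrite /w /psi XE -/d -/Ex subr_lt0 => /ltW.
have Pr : enorm P <= r.
  by rewrite -ler_sqr ?nnegrE ?enorm_ge0 ?(ltW r0)// sqr_enorm ltW.
have Pq : dotp P q <= r * enorm q.
  rewrite (le_trans (ler_norm _))// (le_trans (norm_dotp_le _ _))//.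
  by rewrite ler_wpM2r// enorm_ge0.
have Pb : dotp P b <= r * D.
  rewrite (le_trans (ler_norm _))// (le_trans (norm_dotp_le _ _))//.
  by apply: ler_pM; rewrite ?enorm_ge0.
(* the defect of the barrier, divided by [Ex]; [lam] was chosen so that its terms
   in [d] complete a square, of which [4 alpha r^2] is left *)
pose Br := 8 * (\sum_(c <- cs) dotp P c ^+ 2) - 4 * d * sig - 4 * d * dotp P q - K * d ^+ 2
   - (4 * d * dotp P b - lam * d ^+ 2).
have BrE : Ex * Br <= (n + 2) * eps.
  rewrite sumE in Hsum.
  have -> : Ex * Br = Ex * (8 * (\sum_(c <- cs) dotp P c ^+ 2) - 4 * d * sig)
      + Ex * (- 4 * d * dotp P q) - K * (Ex * d ^+ 2)
      - Ex * (4 * d * dotp P b - lam * d ^+ 2) by rewrite /Br; ring.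
  move: Hsum Hq Ht Kz; rewrite zeq.
  by move: (Ex * _) (Ex * _) (K * _) (Ex * _) => *; lra.
have Br_ge : 4 * alpha * r ^+ 2 <= Br.
  have h1 := ell P.
  have -> : Br = (8 * (\sum_(c <- cs) dotp P c ^+ 2) - 8 * alpha * dotp P P)
     + 4 * d * (r * enorm q - dotp P q) + 4 * d * (r * D - dotp P b)
     + (M * d / (4 * alpha * r) - 2 * r) ^+ 2 * alpha + 4 * alpha * r ^+ 2.
    by rewrite /Br /lam /M /d; field; rewrite !gt_eqF.
  rewrite lerDr; apply: addr_ge0; [apply: addr_ge0; [apply: addr_ge0|]|].
  - by move: h1; lra.
  - by rewrite !mulr_ge0 ?(ltW d0)// subr_ge0.
  - by rewrite !mulr_ge0 ?(ltW d0)// subr_ge0.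
  - by rewrite mulr_ge0 ?sqr_ge0// ltW.
have : eta <= Ex * Br.
  rewrite mulrC /eta; apply: ler_pM => //.
  - by rewrite !mulr_ge0// ?sqr_ge0// ltW.
  - by rewrite mulr_ge0 ?expR_ge0// ltW.
  rewrite /Ex ler_pM2l// ler_expR !mulNr lerN2 ler_wpM2l//; lra.
lra.
Qed.

End Spreading.

(** * A comparison principle *)

Section Comparison.
Variables (R : realType) (N : nat).
Local Notation V := 'rV[R]_N.

(** Were the infimum [- m] negative, it would be approached in a slab
    [|x . e| <= M] only. The function [p], an exponential of [x . e], satisfies
    [sum_c d_c^2 p + d_q p > 0], bounded away from [0] on the slab, and is at most
    [m / 4] there; so subtracting it keeps an almost minimal point inside the slab,
    where the equation for [z] is contradicted. *)
Lemma supersolution_ge0 (cs : seq V) (q e : V) (alpha U : R) (g z : R -> V -> R) :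
  0 < alpha -> alpha <= \sum_(c <- cs) dotp c e ^+ 2 ->
  linear_parabolic cs q g z -> (forall t x, - U <= z t x) ->
  (forall t x, z t x < 0 -> 0 <= g t x) ->
  (forall eps, 0 < eps -> exists M, forall t x, M <= `|dotp x e| -> - eps <= z t x) ->
  forall t x, 0 <= z t x.
Proof.
move=> alpha0 ell [cz Hz] zU g0 zlim t1 x1; rewrite leNgt; apply/negP => z1.
pose Z := range (fun p : R * V => z p.1 p.2).
have infZ : has_inf Z.
  split; first by exists (z t1 x1), (t1, x1).
  by exists (- U) => _ [p _ <-]; exact: zU.
pose m := - inf Z.
have zm t x : - m <= z t x by rewrite opprK; apply: ge_inf; [case: infZ|exists (t, x)].
have m0 : 0 < m by have := zm t1 x1; lra.
have [_ [[t0 x0] _ <-] /= z0] : exists2 y, Z y & y < inf Z + m / 8.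
  by apply: inf_adherent => //; rewrite divr_gt0.
have {}z0 : z t0 x0 < - (7 / 8 * m) by move: z0; rewrite -[inf Z]opprK -/m; lra.
have [M' HM'] : exists M, forall t x, M <= `|dotp x e| -> - (m / 2) <= z t x.
  by apply: zlim; rewrite divr_gt0.
have [M M0 HM] : exists2 M, 0 <= M & forall t x, M <= `|dotp x e| -> - (m / 2) <= z t x.
  by exists (Num.max 0 M') => [|t x]; rewrite ?le_max ?lexx// ge_max => /andP[_ /HM'].
(* large enough for the second derivative of [exp (k s)] to win over the drift *)
pose k := (`|dotp q e| + 1) / alpha.
have k0 : 0 < k by rewrite divr_gt0// ltr_wpDl.
have kq : 1 <= k * alpha + dotp q e.
  rewrite /k divfK ?gt_eqF//; have := ler_norm (- dotp q e); rewrite normrN; lra.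
pose p (x : V) := m / 4 * expR (k * (dotp x e - M)).
pose w t x (_ : R) := z t x - p x.
pose S (_ : R) (x : V) (_ : R) : Prop := `|dotp x e| <= M.
have p_gt0 x : 0 < p x by rewrite mulr_gt0 ?divr_gt0 ?expR_gt0.
have p_le x r : S 0 x r -> p x <= m / 4.
  move=> /(le_trans (ler_norm _)) Sx; rewrite -[leRHS]mulr1 ler_pM2l ?divr_gt0//.
  by rewrite -expR0 ler_expR pmulr_rle0// subr_le0.
have p_ge x r : S 0 x r -> m / 4 * expR (- (2 * k * M)) <= p x.
  rewrite /S ler_norml => /andP[Sx _]; rewrite ler_pM2l ?divr_gt0// ler_expR.
  rewrite (_ : - (2 * k * M) = k * (- M - M)); last by ring.
  by rewrite ler_pM2l// lerD2r.
have cdot : continuous (fun p : R * V * R => dotp p.1.2 e).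
  move=> y; exact: (@continuous_dotp _ _ _ (fun p : R * V * R => p.1.2) (fun=> e) y
    (@continuous_space _ _ y) (@cvg_cst _ _ _ _ _)).
have S_closed : closed [set p : R * V * R | S p.1.1 p.1.2 p.2].
  have /continuous_closedP H := cdot.
  have := closedI (H _ (@closed_ge _ (- M))) (H _ (@closed_le _ M)).
  congr closed; apply/seteqP; rewrite /S; split => y /=; rewrite ler_norml.
    by case=> -> ->.
  by case/andP.
have w_cont : continuous (fun p : R * V * R => w p.1.1 p.1.2 p.2).
  move=> y; have c1 := @continuous_time _ _ y; have c2 := @continuous_space _ _ y.
  apply: cvgB; first exact: (continuous_comp2 cz c1 c2).
  apply: cvgM; first exact: cvg_cst.
  apply: (continuous_comp (f := fun p : R * V * R => k * (dotp p.1.2 e - M)) (g := @expR R)).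
    by apply: cvgM; [exact: cvg_cst|apply: cvgB; [exact: cdot|exact: cvg_cst]].
  exact: continuous_expR.
have S0 : S t0 x0 0.
  by rewrite /S leNgt; apply/negP => /ltW /(HM t0); move: z0; lra.
have w_ge t x r : S t x r -> - m - m / 4 <= w t x r.
  by move=> Sx; have := p_le x r Sx; have := zm t x; rewrite /w; lra.
pose n : R := (size cs)%:R; have n0 : 0 <= n by rewrite ler0n.
pose eta := k * (m / 4 * expR (- (2 * k * M))).
have eta0 : 0 < eta by rewrite mulr_gt0// mulr_gt0 ?divr_gt0 ?expR_gt0.
pose eps := Num.min (eta / (n + 3)) (m / 8).
have n3 : 0 < n + 3 by rewrite ltr_wpDl.
have eps0 : 0 < eps by rewrite lt_min !divr_gt0.
have epsn : eps * (n + 3) <= eta by rewrite -ler_pdivlMr// ge_min lexx.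
have epsm : eps <= m / 8 by rewrite ge_min lexx orbT.
have [t [x [r [Sr wr dt dx _]]]] := @almost_minimum _ _ S w
  _ (\sum_(b <- q :: cs) dotp b b) eps t0 x0 0 S_closed w_cont w_ge S0 eps0.
have {}wr : w t x r < - (3 / 4 * m).
  by move: wr; rewrite {2}/w; have := p_gt0 x0; lra.
have zneg : z t x < 0 by move: wr; rewrite /w; have := p_le x r Sr; lra.
have Slt : `|dotp x e| < M.
  rewrite lt_neqAle [X in _ && X]Sr andbT; apply/eqP => xM.
  have := HM t x; rewrite xM => /(_ (lexx _)); move: wr; rewrite /w.
  by have := p_le x r Sr; lra.
have [zt [d1 [d2 [jzt jzx zeq]]]] := Hz t x.
have jp c : jet2 (fun h => p (x + h *: c)) (k * dotp c e * p x) (k ^+ 2 * dotp c e ^+ 2 * p x).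
  have := jet2_expR (m / 4) (k * (dotp x e - M)) (k * dotp c e).
  congr jet2; [|by rewrite /p; ring|by rewrite /p; ring].
  by apply/funext => h; rewrite /p dotpDl dotpZl; congr (_ * expR _); ring.
have Ht : zt <= eps.
  apply: dt; last by exists 1.
  by have := jet1B jzt (jet1_cst (p x)); rewrite subr0.
have Hx c : c \in q :: cs -> `|d1 c - k * dotp c e * p x| <= eps /\
    - eps <= d2 c - k ^+ 2 * dotp c e ^+ 2 * p x.
  move=> cq; apply: (dx c _ _ (dotp_le_sum cq)); first exact: jet2B.
  pose a := `|dotp c e| + 1; have a0 : 0 < a by rewrite ltr_wpDl.
  exists ((M - `|dotp x e|) / a); first by rewrite divr_gt0// subr_gt0.
  move=> h; rewrite ltr_pdivlMr// => hr; rewrite /S dotpDl dotpZl.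
  rewrite (le_trans (ler_normD _ _))// normrM.
  have : `|h| * `|dotp c e| <= `|h| * a by rewrite ler_wpM2l// lerDl.
  by lra.
have [|+ _] := Hx q; first by rewrite inE eqxx.
rewrite ler_norml => /andP[Hq _].
have Hsum : \sum_(c <- cs) (k ^+ 2 * dotp c e ^+ 2 * p x - d2 c) <= n * eps.
  by apply: sumr_le_size => c cc; have [|_] := Hx c; [rewrite inE cc orbT|lra].
have g_ge0 := g0 _ _ zneg.
have sumE : \sum_(c <- cs) (k ^+ 2 * dotp c e ^+ 2 * p x - d2 c) =
    k * p x * (k * \sum_(c <- cs) dotp c e ^+ 2) - \sum_(c <- cs) d2 c.
  rewrite sumrB; congr (_ - _).
  by rewrite !mulr_sumr; apply: eq_bigr => c _; ring.
have kp0 : 0 < k * p x by rewrite mulr_gt0.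
have h1 : eta <= k * p x by rewrite ler_pM2l//; exact: (p_ge x r Sr).
have h2 : k * p x <= k * p x * (k * (\sum_(c <- cs) dotp c e ^+ 2) + dotp q e).
  rewrite ler_pMr// (le_trans kq)// lerD2r ler_pM2l//.
move: Hsum Hq Ht h2; rewrite sumE zeq.
have -> : k * dotp q e * p x = k * p x * dotp q e by ring.
by rewrite mulrDr; lra.
Qed.

End Comparison.

(** * Consequences of ellipticity *)

Section Ellipticity.
Variables (R : realType) (N : nat).
Local Notation V := 'rV[R]_N.
Variable A : 'M[R]_N.
Hypothesis A_elliptic : elliptic A.

Let S := 2^-1 *: (A + A^T).

Let S_form x : dotp (x *m S) x = \sum_i \sum_j A i j * x 0 i * x 0 j.
Proof.
have E (B : 'M[R]_N) : dotp (x *m B) x = \sum_i \sum_j B i j * x 0 i * x 0 j.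
  rewrite exchange_big; apply: eq_bigr => j _; rewrite mxE mulr_suml.
  by apply: eq_bigr => i _; rewrite -mulrA mulrCA mulrA.
have ET : dotp (x *m A^T) x = dotp (x *m A) x.
  rewrite !E exchange_big; apply: eq_bigr => i _; apply: eq_bigr => j _.
  by rewrite mxE mulrAC.
rewrite /S -scalemxAr dotpZl mulmxDr dotpDl ET -E.
  by field.
Qed.

Let S_sym : S^T = S.
Proof. by apply/matrixP => i j; rewrite !mxE addrC. Qed.

Let form_sum_squares (cs : seq V) x :
  dotp (x *m (\sum_(c <- cs) c^T *m c)) x = \sum_(c <- cs) dotp x c ^+ 2.
Proof.
elim: cs => [|c cs IH]; first by rewrite !big_nil mulmx0 dotp0l.
rewrite !big_cons mulmxDr dotpDl IH; congr (_ + _).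
rewrite mulmxA (_ : x *m c^T *m c = dotp x c *: c) ?dotpZl ?(dotpC c)//.
apply/rowP => j; rewrite !mxE big_ord1 mxE; congr (_ * _).
by apply: eq_bigr => i _; rewrite mxE.
Qed.

(** The part [kap^2 eta eta^T] may be split off because the remaining form is
    still bounded below, by [alpha1 - kap^2]. *)
Lemma elliptic_sum_squares : exists2 alpha, 0 < alpha &
  (exists2 cs : seq V, 2^-1 *: (A + A^T) = \sum_(c <- cs) c^T *m c &
     forall x, alpha * dotp x x <= \sum_(c <- cs) dotp x c ^+ 2) /\
  forall kap (eta : V), kap ^+ 2 < alpha -> dotp eta eta = 1 ->
    exists cs : seq V, 2^-1 *: (A + A^T) = \sum_(c <- kap *: eta :: cs) c^T *m c.
Proof.
have [alpha [alpha2 [alpha0 _ ell']]] := A_elliptic.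
have ell x : alpha * dotp x x <= dotp (x *m S) x.
  by rewrite S_form -sqr_enorm; have /andP[] := ell' x.
exists alpha => //; split=> [|kap eta kapa eta1].
  have [cs csE] := positive_form_sum_squares alpha0 S_sym ell.
  by exists cs => // x; rewrite -form_sum_squares -csE.
pose T := S - \sum_(c <- [:: kap *: eta]) c^T *m c.
have [|||cs csE] := @positive_form_sum_squares _ _ (alpha - kap ^+ 2) T.
- by rewrite subr_gt0.
- rewrite /T big_seq1 linearB/= S_sym; congr (_ - _).
  by apply/matrixP => i j; rewrite !mxE !big_ord1 !mxE mulrC.
- move=> x; rewrite mulmxBr dotpDl dotpNl form_sum_squares big_seq1 mulrBl.
  rewrite lerD ?ell// lerN2 dotpZr exprMn ler_wpM2l ?sqr_ge0//.
  by rewrite (le_trans (sqr_dotp_le _ _))// eta1 mulr1.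
by exists cs; rewrite big_cons -csE /T big_seq1 [RHS]addrC subrK.
Qed.

End Ellipticity.

Section SpaceLipschitz.
Variables (R : realType) (N : nat).
Local Notation V := 'rV[R]_N.

(** Interior gradient estimates are replaced by [increment_le], applied in the
    direction of [x - y], which can be made one of the directions of the
    decomposition of [A] with a length [kap] depending on the ellipticity only.
    The hypothesis on [F] only bounds the difference of the sources at points at
    distance at most [2]; the sources themselves may be unbounded. *)
Lemma solution_space_lipschitz (A : 'M[R]_N) (q : V) (F : V -> R -> R)
    (u : R -> V -> R) (U G : R) :
  elliptic A -> classical_solution A q F u -> (forall t x, `|u t x| <= U) -> 0 <= G ->
  (forall t x y, enorm (x - y) <= 2 -> F x (u t x) - F y (u t y) <= G) ->
  exists2 L, 0 <= L & forall t x y, u t x - u t y <= L * enorm (x - y).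
Proof.
move=> Aell usol uU G0 FG.
have [alpha alpha0 [_ split_off]] := elliptic_sum_squares Aell.
(* [kap <= 1] keeps the two points at distance at most [2] *)
pose kap := Num.min 1 (Num.min 1 alpha / 2).
have kap0 : 0 < kap by rewrite !lt_min ltr01/= divr_gt0// lt_min ltr01.
have kap1 : kap <= 1 by rewrite ge_min lexx.
have kapa : kap ^+ 2 < alpha.
  have : kap ^+ 2 <= kap by rewrite expr2 ler_piMl// ltW.
  move/le_lt_trans; apply; apply: (@le_lt_trans _ _ (alpha / 2)).
    by rewrite ge_min ler_pM2r ?invr_gt0// ge_min lexx !orbT.
  by rewrite ltr_pdivrMr// ltr_pMr// ltr1n.
have U0 : 0 <= U := le_trans (normr_ge0 _) (uU 0 0).
pose C := 2 * U + (G + 1) / 2.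
have C0 : 0 <= C by rewrite addr_ge0 ?mulr_ge0 ?divr_ge0// addr_ge0.
exists (C / (2 * kap)); first by rewrite divr_ge0// mulr_ge0// ltW.
move=> t x y; have [->|xy] := eqVneq x y.
  by rewrite !subrr /enorm dotp0l sqrtr0 mulr0.
have d0 : 0 < enorm (x - y).
  rewrite lt_def enorm_ge0 andbT; apply: contraNneq xy => d0.
  rewrite -subr_eq0; apply/eqP/dotp_eq0; by rewrite -sqr_enorm d0 expr0n.
pose d := enorm (x - y); pose r := d / (2 * kap).
have k20 : 0 < 2 * kap by rewrite mulr_gt0.
rewrite (_ : _ / _ * _ = C * r); last by rewrite /r /d mulrAC mulrA.
have r0 : 0 < r by rewrite divr_gt0.
have [r1|r1] := leP r 1; last first.
  apply: (@le_trans _ _ (C * 1)); last by rewrite ler_wpM2l// ltW.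
  have : 0 <= (G + 1) / 2 by rewrite divr_ge0// addr_ge0.
  by have := uU t x; have := uU t y; rewrite !ler_norml /C; lra.
pose eta := d^-1 *: (x - y).
have eta1 : dotp eta eta = 1.
  by rewrite dotpZl dotpZr -sqr_enorm -/d; field; rewrite gt_eqF.
have [cs csE] := split_off kap eta kapa eta1.
have upde := classical_solution_linear_parabolic usol csE.
pose mid := 2^-1 *: (x + y).
have rc : r *: (kap *: eta) = 2^-1 *: (x - y).
  by rewrite /r /eta !scalerA; congr (_ *: _); field; rewrite !gt_eqF.
have := increment_le upde uU G0 _ t mid (r := r).
rewrite rc /mid -scalerDr -scalerBr.
have -> : 2^-1 *: (x + y + (x - y)) = x by apply/rowP => i; rewrite !mxE; field.
have -> : 2^-1 *: (x + y - (x - y)) = y by apply/rowP => i; rewrite !mxE; field.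
apply.
  move=> t' x' r' /andP[r'0 r'1]; apply: FG.
  have -> : x' + r' *: (kap *: eta) - (x' - r' *: (kap *: eta)) = (2 * r' * kap) *: eta.
    by apply/rowP => i; rewrite !mxE; ring.
  rewrite enormZ /enorm eta1 sqrtr1 mulr1 ger0_norm.
    by rewrite -mulrA -[leRHS]mulr1 ler_pM2l// mulr_ile1// ltW.
  by rewrite !mulr_ge0// ltW.
by rewrite (ltW r0).
Qed.

End SpaceLipschitz.

(** * The sliding method *)

Section Sliding.
Variables (R : realType) (N : nat).
Local Notation V := 'rV[R]_N.
Variables (e q : V) (cs : seq V) (alpha : R) (f : R -> R -> R) (pm pp : R -> R).
Variables (delta gap U K L : R) (u : R -> V -> R).
Hypotheses (e1 : dotp e e = 1) (alpha0 : 0 < alpha)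
  (ell : forall x, alpha * dotp x x <= \sum_(c <- cs) dotp x c ^+ 2).
Hypotheses (f_nonincr : forall s a b, a <= b -> f b s <= f a s)
  (pm_nonincr : forall a b, a <= b -> pm b <= pm a)
  (pp_nonincr : forall a b, a <= b -> pp b <= pp a).
Hypotheses (delta0 : 0 < delta)
  (f_pm : forall a s s', s <= s' -> s' <= pm a + delta -> f a s' <= f a s)
  (f_pp : forall a s s', pp a - delta <= s -> s <= s' -> f a s' <= f a s).
Hypotheses (gap0 : 0 < gap) (gapP : forall a, gap <= pp a - pm a).
Hypotheses (u_pde : linear_parabolic cs q (fun t x => f (dotp x e) (u t x)) u)
  (uU : forall t x, `|u t x| <= U)
  (K0 : 0 <= K) (fK : forall a s s', `|s| <= U -> `|s'| <= U ->
     `|f a s - f a s'| <= K * `|s - s'|)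
  (L0 : 0 <= L) (uL : forall t x y, u t x - u t y <= L * enorm (x - y)).
Hypothesis u_lim : forall eps, 0 < eps -> exists2 B, 0 <= B & forall t x,
  (dotp x e <= - B -> `|u t x - pp (dotp x e)| <= eps) /\
  (B <= dotp x e -> `|u t x - pm (dotp x e)| <= eps).

Variables (s : R) (eta : V).
Hypothesis eta_e : dotp eta e = 0.

Let zeta tau := eta + tau *: e.
Let z tau t x := u t x - u (t + s) (x + zeta tau).

Let dotp_zeta x tau : dotp (x + zeta tau) e = dotp x e + tau.
Proof. by rewrite !dotpDl dotpZl eta_e e1 add0r mulr1. Qed.

Let z_pde tau : linear_parabolic cs q (fun t x =>
    f (dotp x e) (u t x) - f (dotp x e + tau) (u (t + s) (x + zeta tau))) (z tau).
Proof.
have := linear_parabolicB u_pde (linear_parabolic_shift s (zeta tau) u_pde).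
congr linear_parabolic; apply/funext => t; apply/funext => x.
by rewrite dotp_zeta.
Qed.

Let z_lip_x tau t x y : z tau t x - z tau t y <= 2 * L * enorm (x - y).
Proof.
rewrite /z; have h1 := uL t x y.
have := uL (t + s) (y + zeta tau) (x + zeta tau).
rewrite (_ : y + zeta tau - (x + zeta tau) = -1 *: (x - y)); last first.
  by rewrite scaleN1r opprD addrACA subrr addr0 opprB.
by rewrite enormZ normrN1 mul1r; lra.
Qed.

Let z_lip_tau tau tau' t x : z tau t x - z tau' t x <= L * `|tau - tau'|.
Proof.
rewrite /z; have := uL (t + s) (x + zeta tau') (x + zeta tau).
rewrite (_ : x + zeta tau' - (x + zeta tau) = (tau' - tau) *: e); last first.
  by apply/rowP => i; rewrite !mxE; ring.
by rewrite enormZ /enorm e1 sqrtr1 mulr1 distrC; lra.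
Qed.

(** For [x . e <= - B] the solution, and for [x . e + tau >= B] its translate,
    lies in a range where [f (x . e)] is nonincreasing in [u]; as [f], [p^+] and
    [p^-] are nonincreasing in [x . e], moving by [tau >= 0] only helps. So the
    source of [z] is nonnegative where [z < 0], and [z] has nonnegative limits as
    [x . e] tends to either infinity. *)
Let slide_ge0 tau B : 0 <= tau ->
  (forall t x, (dotp x e <= - B -> `|u t x - pp (dotp x e)| <= delta) /\
    (B <= dotp x e -> `|u t x - pm (dotp x e)| <= delta)) ->
  (forall t x, z tau t x < 0 -> dotp x e <= - B \/ B <= dotp x e + tau) ->
  forall t x, 0 <= z tau t x.
Proof.
move=> tau0 HB zB.
apply: (supersolution_ge0 (e := e) (U := 2 * U) alpha0 _ (z_pde tau)) => [|t x|t x zneg|eps eps0].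
- have := ell e; rewrite e1 mulr1 => /le_trans; apply; apply: ler_sum => c _.
  by rewrite dotpC.
- by have := uU t x; have := uU (t + s) (x + zeta tau); rewrite /z !ler_norml; lra.
- have uv : u t x <= u (t + s) (x + zeta tau) by move: zneg; rewrite /z; lra.
  rewrite subr_ge0; apply: (@le_trans _ _ (f (dotp x e) (u (t + s) (x + zeta tau)))).
    by apply: f_nonincr; rewrite lerDl.
  have [xB|xB] := zB _ _ zneg.
    apply: f_pp => //; have [/(_ xB) + _] := HB t x.
    by rewrite ler_norml => /andP[]; lra.
  apply: f_pm => //; have [_] := HB (t + s) (x + zeta tau); rewrite dotp_zeta.
  move=> /(_ xB); rewrite ler_norml => /andP[_].
  have : pm (dotp x e + tau) <= pm (dotp x e) by apply: pm_nonincr; rewrite lerDl.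
  by lra.
- have e2 : 0 < eps / 2 by rewrite divr_gt0.
  have [M M0 HM] := u_lim e2; exists (M + tau) => t x.
  rewrite ler_normr => /orP[] Mx; rewrite /z.
  + have [_ /(_ ltac:(lra))] := HM t x.
    have [_] := HM (t + s) (x + zeta tau); rewrite dotp_zeta => /(_ ltac:(lra)).
    have : pm (dotp x e + tau) <= pm (dotp x e) by apply: pm_nonincr; rewrite lerDl.
    by rewrite !ler_norml; lra.
  + have [/(_ ltac:(lra)) + _] := HM t x.
    have [+ _] := HM (t + s) (x + zeta tau); rewrite dotp_zeta => /(_ ltac:(lra)).
    have : pp (dotp x e + tau) <= pp (dotp x e) by apply: pp_nonincr; rewrite lerDl.
    by rewrite !ler_norml; lra.
Qed.

Let telescope tau t x k :
  \sum_(0 <= j < k) z tau (t + j%:R * s) (x + j%:R *: zeta tau) =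
  u t x - u (t + k%:R * s) (x + k%:R *: zeta tau).
Proof.
elim: k => [|k IH]; first by rewrite big_geq// mul0r scale0r !addr0 subrr.
rewrite big_nat_recr//= IH /z subrKA -natr1.
by rewrite scalerDl mulrDl scale1r mul1r !addrA.
Qed.

(** Along the orbit [(t + j s, x + j zeta)] the solution goes from near [p^+] to
    near [p^-] in a fixed number [k] of steps, so one of the [k] increments is at
    least [gap / (2 k)]. By the Lipschitz bound it stays positive on a ball of
    fixed radius, and the positivity spreads to all later points of the strip. *)
Let slide_strip_gt0 tau B : 0 < tau -> 0 <= B -> (forall t x, 0 <= z tau t x) ->
  exists2 m, 0 < m & forall t x, `|dotp x e| <= B -> m <= z tau t x.
Proof.
move=> tau0 B0 z0.
have [B1 B10 HB1] : exists2 B1, 0 <= B1 & forall t x,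
    (dotp x e <= - B1 -> `|u t x - pp (dotp x e)| <= gap / 4) /\
    (B1 <= dotp x e -> `|u t x - pm (dotp x e)| <= gap / 4).
  by apply: u_lim; rewrite divr_gt0.
pose k := (Num.bound (2 * B1 / tau)).+1; have k0 : 0 < k%:R :> R by rewrite ltr0n.
have kB : 2 * B1 <= k%:R * tau.
  rewrite -ler_pdivrMr// ltW// (lt_trans (archi_boundP _))//.
    by rewrite divr_ge0 ?mulr_ge0// ltW.
  by rewrite ltr_nat.
pose kap := gap / (2 * k%:R); have kap0 : 0 < kap by rewrite divr_gt0// mulr_gt0.
have orbit t x : dotp x e = - B1 -> exists2 j, (j < k)%N &
    kap <= z tau (t + j%:R * s) (x + j%:R *: zeta tau).
  move=> xB1; apply: contrapT => H.
  have : \sum_(0 <= j < k) z tau (t + j%:R * s) (x + j%:R *: zeta tau) <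
      \sum_(0 <= j < k) kap.
    apply: ltr_sum_nat => // j /andP[_ jk]; rewrite ltNge; apply/negP => kz.
    by apply: H; exists j.
  rewrite telescope sumr_const_nat subn0 -[kap *+ k]mulr_natl.
  have -> : k%:R * kap = gap / 2 by rewrite /kap; field; rewrite gt_eqF.
  have [+ _] := HB1 t x; rewrite xB1 lexx => /(_ isT).
  have [_] := HB1 (t + k%:R * s) (x + k%:R *: zeta tau).
  have -> : dotp (x + k%:R *: zeta tau) e = - B1 + k%:R * tau.
    by rewrite dotpDl dotpZl xB1 dotpDl dotpZl eta_e e1 add0r mulr1.
  move=> /(_ ltac:(lra)).
  have : pm (- B1 + k%:R * tau) <= pm (- B1).
    by apply: pm_nonincr; rewrite lerDl mulr_ge0// ltW.
  by have := gapP (- B1); rewrite !ler_norml; lra.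
pose r := kap / (4 * (L + 1)).
have L1 : 0 < L + 1 by rewrite ltr_wpDl.
have r0 : 0 < r by rewrite divr_gt0// mulr_gt0.
have rL : 2 * L * r <= kap / 2.
  rewrite (_ : kap / 2 = 2 * (L + 1) * r); last by rewrite /r; field; rewrite gt_eqF.
  by rewrite ler_wpM2r ?(ltW r0)//; lra.
have D0 : 0 <= B + B1 + k%:R * enorm (zeta tau).
  by rewrite !addr_ge0// mulr_ge0// enorm_ge0.
have kap2 : 0 < kap / 2 by rewrite divr_gt0.
have [m m0 Hm] := @positivity_spreads _ _ cs q alpha K r (1 + 2 * (k%:R * `|s|))
  (B + B1 + k%:R * enorm (zeta tau)) (kap / 2) alpha0 ell K0 r0 D0 kap2.
exists m => // t0 x0; rewrite ler_norml => /andP[x0B x0B'].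
(* the orbit starts early enough for its times not to exceed [t0 - 1],
   whatever the sign of [s] *)
have [|j jk zj] := orbit (t0 - 1 - k%:R * `|s|) (x0 - (dotp x0 e + B1) *: e).
  by rewrite dotpDl dotpNl dotpZl e1 mulr1; ring.
set t1 := _ + _ in zj; set y := _ + _ in zj.
have jk' : j%:R <= k%:R :> R by rewrite ler_nat ltnW.
have js : `|j%:R * s| <= k%:R * `|s| by rewrite normrM ger0_norm// ler_wpM2r.
apply: (Hm _ _ (z_pde tau) z0 _ t1 t0 y x0).
- move=> t x.
  have := fK (dotp x e) (uU t x) (uU (t + s) (x + zeta tau)).
  rewrite -/(z tau t x) (ger0_norm (z0 t x)) ler_norml => /andP[h _].
  have : f (dotp x e + tau) (u (t + s) (x + zeta tau)) <=
    f (dotp x e) (u (t + s) (x + zeta tau)) by apply: f_nonincr; rewrite lerDl ltW.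
  by lra.
- by move: js; rewrite ler_norml /t1 => /andP[]; lra.
- rewrite (_ : x0 - y = (dotp x0 e + B1) *: e + (- j%:R) *: zeta tau); last first.
    by rewrite /y; apply/rowP => i; rewrite !mxE; ring.
  rewrite (le_trans (enormD _ _))// !enormZ lerD//.
    rewrite /enorm e1 sqrtr1 mulr1 (le_trans (ler_normD _ _))// (ger0_norm B10) lerD2r.
    by rewrite ler_norml x0B.
  by rewrite normrN ger0_norm// ler_wpM2r ?enorm_ge0.
- move=> x xy; have := z_lip_x tau t1 y x.
  have : 2 * L * enorm (y - x) <= 2 * L * r.
    rewrite ler_wpM2l ?mulr_ge0// (le_trans _ xy)//.
    by rewrite -opprB -scaleN1r enormZ normrN1 mul1r.
  by lra.
Qed.

(** Let [ts] be the least shift beyond which [u] stays above its translates. If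
    [ts > 0], the gap at [ts] is bounded below on the strip [|x . e| <= B], so it
    remains nonnegative there for slightly smaller shifts, hence everywhere by
    comparison: [ts] was not least. *)
Lemma sliding : forall t x, u (t + s) (x + eta) <= u t x.
Proof.
have [B B0 HB] := u_lim delta0.
suff good tau : 0 <= tau -> forall t x, 0 <= z tau t x.
  by move=> t x; have := good 0 (lexx _) t x; rewrite /z /zeta scale0r addr0 subr_ge0.
have large tau' : 2 * B <= tau' -> forall t x, 0 <= z tau' t x.
  move=> tB; apply: (slide_ge0 _ HB) => [|t x _]; first lra.
  by have [xB|xB] := leP (dotp x e) (- B); [left|right; lra].
pose bad := [set tau' | 0 <= tau' /\ exists t x, z tau' t x < 0].
move=> tau0 t x; rewrite leNgt; apply/negP => ztau.
have bad_tau : bad tau by split=> //; exists t, x.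
have bad_sup : has_sup bad.
  split; first by exists tau.
  exists (2 * B) => tau' [_ [t' [x' zneg]]]; rewrite leNgt; apply/negP => /ltW tB.
  by have := large _ tB t' x'; rewrite leNgt zneg.
pose ts := sup bad.
have bad_le tau' : bad tau' -> tau' <= ts by apply: ub_le_sup; case: bad_sup.
have L1 : 0 < L + 1 by rewrite ltr_wpDl.
have good_ts t' x' : 0 <= z ts t' x'.
  rewrite leNgt; apply/negP => zneg.
  pose h := - z ts t' x' / (L + 1).
  have h0 : 0 < h by rewrite divr_gt0// oppr_gt0.
  suff /bad_le : bad (ts + h) by rewrite leNgt ltrDl h0.
  split; first by rewrite addr_ge0 ?(ltW h0)// (le_trans tau0)// bad_le.
  exists t', x'; have := z_lip_tau (ts + h) ts t' x'.
  rewrite [ts + h]addrC addrK gtr0_norm//.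
  have : (L + 1) * h = - z ts t' x' by rewrite /h; field; rewrite gt_eqF.
  by lra.
have ts0 : 0 < ts.
  rewrite lt_neqAle (le_trans tau0 (bad_le _ bad_tau)) andbT; apply/eqP => ts0.
  have : tau = ts by apply: le_anti; rewrite bad_le// -ts0.
  by move=> tE; move: ztau; rewrite tE ltNge good_ts.
have [m m0 Hm] := slide_strip_gt0 ts0 B0 good_ts.
have [tau1 bad1 tau1_gt] : exists2 tau1, bad tau1 & ts - m / (L + 1) < tau1.
  by apply: sup_adherent => //; rewrite divr_gt0.
case: (bad1) => tau10 [t1 [x1]]; rewrite ltNge; apply/negP/negPn.
apply: (slide_ge0 tau10 HB) => t' x' zneg.
have [xB|xB] := leP (dotp x' e) (- B); first by left.
right; rewrite leNgt; apply/negP => xB'.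
have := Hm t' x'; rewrite ler_norml (ltW xB) /= => /(_ ltac:(lra)) zm.
have := z_lip_tau ts tau1 t' x'.
rewrite ger0_norm ?subr_ge0 ?bad_le//.
have : (L + 1) * (ts - tau1) <= m.
  by rewrite mulrC -ler_pdivlMr//; lra.
have := bad_le _ bad1.
by lra.
Qed.

End Sliding.

Lemma bounded_fun_le (R : realType) (T : Type) (g : T -> R) : bounded_fun g ->
  exists U, forall x, `|g x| <= U.
Proof. by move=> /pinfty_ex_gt0[U _ HU]; exists U => x; exact: HU. Qed.

Unset Implicit Arguments.

Theorem corollary1p16 (R : realType) (N : nat) (N_ge1 : (1 <= N)%N)
    (e : 'rV[R]_N) (e_unit : enorm e = 1)
    (A : 'M[R]_N) (A_elliptic : elliptic A) (q : 'rV[R]_N)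
    (f : R -> R -> R)
    (beta : R) (beta_gt0 : 0 < beta)
    (f_holder : holder_in_x beta (fun x : 'rV[R]_N => f (dotp x e)))
    (f_lipschitz : locally_lipschitz_in_u (fun x : 'rV[R]_N => f (dotp x e)))
    (f_nonincr : forall s, nonincreasing_fun (f ^~ s))
    (pm pp : R -> R)
    (pm_bounded : bounded_fun pm) (pp_bounded : bounded_fun pp)
    (pm_sol : classical_solution A q (fun x => f (dotp x e))
                (fun _ x => pm (dotp x e)))
    (pp_sol : classical_solution A q (fun x => f (dotp x e))
                (fun _ x => pp (dotp x e)))
    (pm_nonincr : nonincreasing_fun pm) (pp_nonincr : nonincreasing_fun pp)
    (delta : R) (delta_gt0 : 0 < delta)
    (f_nonincr_pm : forall x : 'rV[R]_N,
        {in `]-oo, pm (dotp x e) + delta] &,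
          nonincreasing_fun (f (dotp x e))})
    (f_nonincr_pp : forall x : 'rV[R]_N,
        {in `[pp (dotp x e) - delta, +oo[ &,
          nonincreasing_fun (f (dotp x e))})
    (gap : 0 < inf [set pp (dotp x e) - pm (dotp x e) | x in [set: 'rV[R]_N]])
    (xi : R -> R) (xi_bounded : bounded_fun xi)
    (u : R -> 'rV[R]_N -> R)
    (u_bounded : bounded_fun (fun z : R * 'rV[R]_N => u z.1 z.2))
    (u_wave : transition_wave A q (fun x => f (dotp x e)) e pm pp xi u) :
  exists phi : R -> R, forall t x, u t x = phi (dotp x e).
Proof.
have e1 : dotp e e = 1 by rewrite -sqr_enorm e_unit expr1n.
have onto a : dotp (a *: e) e = a by rewrite dotpZl e1 mulr1.
have [U uU'] := bounded_fun_le u_bounded.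
have uU t x : `|u t x| <= U := uU' (t, x).
have U0 : 0 <= U := le_trans (normr_ge0 _) (uU 0 0).
have [X xiX] := bounded_fun_le xi_bounded.
have [u_sol _ _ u_lim] := u_wave.
have [C HC] := f_holder U.
have [K' HK'] := f_lipschitz U.
have fK a s s' : `|s| <= U -> `|s'| <= U -> `|f a s - f a s'| <= `|K'| * `|s - s'|.
  move=> sU sU'; rewrite -(onto a); apply: le_trans (HK' _ _ _ sU sU') _.
  by rewrite ler_wpM2r// ler_norm.
have [L L0 uL] : exists2 L, 0 <= L & forall t x y, u t x - u t y <= L * enorm (x - y).
  apply: (solution_space_lipschitz (G := `|C| * 2 `^ beta + `|K'| * (2 * U)) A_elliptic u_sol uU).
    by rewrite addr_ge0// mulr_ge0// ?powR_ge0// mulr_ge0.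
  move=> t x y xy.
  rewrite -(subrKA (f (dotp y e) (u t x))) lerD//.
    apply: le_trans (ler_norm _) _; apply: le_trans (HC _ x y (uU t x)) _.
    rewrite (@le_trans _ _ (`|C| * enorm (x - y) `^ beta))//.
      by rewrite ler_wpM2r ?powR_ge0// ler_norm.
    by rewrite ler_wpM2l// ge0_ler_powR ?nnegrE ?enorm_ge0// ltW.
  apply: le_trans (ler_norm _) _; apply: le_trans (fK _ _ _ (uU t x) (uU t y)) _.
  rewrite ler_wpM2l//.
  by have := uU t x; have := uU t y; rewrite !ler_norml; lra.
have [alpha alpha0 [[cs csE ell] _]] := elliptic_sum_squares A_elliptic.
have u_pde := classical_solution_linear_parabolic u_sol csE.
have u_lim0 eps : 0 < eps -> exists2 B, 0 <= B & forall t x,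
    (dotp x e <= - B -> `|u t x - pp (dotp x e)| <= eps) /\
    (B <= dotp x e -> `|u t x - pm (dotp x e)| <= eps).
  move=> eps0; have [M M0 HM] := u_lim _ eps0.
  have X0 : 0 <= X := le_trans (normr_ge0 _) (xiX 0).
  exists (M + X) => [|t x]; first by rewrite addr_ge0.
  have [H1 H2] := HM t x; have := xiX t; rewrite ler_norml => /andP[X1 X2].
  by split=> xB; [apply: H1|apply: H2]; lra.
set P := [set _ | x in _] in gap.
have P_inf : has_inf P.
  by apply: contrapT => /inf_out P0; move: gap; rewrite P0 ltxx.
have gapP a : inf P <= pp a - pm a.
  apply: ge_inf; first by case: P_inf.
  by exists (a *: e); rewrite ?onto.
have f_nonincr' s a b : a <= b -> f b s <= f a s by exact: f_nonincr.
have pm_nonincr' a b : a <= b -> pm b <= pm a by exact: pm_nonincr.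
have pp_nonincr' a b : a <= b -> pp b <= pp a by exact: pp_nonincr.
have f_pm a s s' : s <= s' -> s' <= pm a + delta -> f a s' <= f a s.
  move=> ss' s'p; have := f_nonincr_pm (a *: e); rewrite onto; apply=> //.
  by rewrite in_itv/= (le_trans ss').
have f_pp a s s' : pp a - delta <= s -> s <= s' -> f a s' <= f a s.
  move=> sp ss'; have := f_nonincr_pp (a *: e); rewrite onto; apply=> //.
    by rewrite in_itv/= sp.
  by rewrite in_itv/= (le_trans sp).
have slide s eta : dotp eta e = 0 -> forall t x, u (t + s) (x + eta) <= u t x.
  move=> eta_e.
  exact: (sliding e1 alpha0 ell f_nonincr' pm_nonincr' pp_nonincr' delta_gt0 f_pm f_pp
    gap gapP u_pde uU (normr_ge0 K') fK L0 uL u_lim0 s eta_e).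
exists (fun a => u 0 (a *: e)) => t x.
apply: le_anti; apply/andP; split.
- have := slide t (x - dotp x e *: e) _ 0 (dotp x e *: e).
  by rewrite add0r [_ *: e + _]addrC subrK; apply; rewrite dotpDl dotpNl onto subrr.
- have := slide (- t) (dotp x e *: e - x) _ t x.
  by rewrite subrr [x + _]addrC subrK; apply; rewrite dotpDl dotpNl onto subrr.
Qed.
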